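(* Let $\xi_1,\xi_2,\ldots$ be i.i.d.\ nonnegative real random variables whose right tail satisfies $\overline F(x):=\P(\xi_1\geq x)=x^{-1}\ell(x)$ for $x\to\infty$, where $\ell$ is a slowly varying function. Define $G(x):=\int_0^x\overline F(t)\,dt$ for $x\geq 0$, $S_n:=\sum_{i=1}^n\xi_i$ and $\overline F_n(x):=\P(S_n\geq x)$. Then: (a) For a positive sequence $(x_n)_{n\geq1}$, $$\lim_{n\to\infty}\sup_{x\geq x_n}\left|\frac{\overline F_n(x)}{n\overline F(x)}-1\right|=0$$ holds if and only if $\lim_{n\to\infty}\frac{x_n}{nG(x_n)}=\infty$. (b) Let $(x_n)_{n\geq1}$ and $(x_n')_{n\geq1}$ be positive sequences such that $x_n\leq x_n'$ for all $n$, $\liminf_{n\to\infty}\frac{x_n}{nG(x_n)}>0$ and $\limsup_{n\to\infty}\frac{x_n'}{nG(x_n')}<\infty$. Then for any positive sequence $(a_n)_{n\geq1}$ with $\lim_{n\to\infty}a_n\in(0,\infty)$, $$\lim_{n\to\infty}\sup_{x_n\leq x\leq x_n'}\left|\frac{\overline F_n\left(nG(x)+a_nx\right)}{n\overline F(a_nx)}-1\right|=0.$$ (c) If $(x_n)_{n\geq 1}$ is a positive sequence with $\limsup_{n\to\infty}\frac{x_n}{nG(x_n)}=0$, then $\lim_{n\to\infty}\overline F_n(x_n)=1$.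
   Context: A function $\ell$ is slowly varying if $\ell(\lambda x)/\ell(x)\to1$ as $x\to\infty$ for every $\lambda>0$. *)

(* Defs.v *)
From HB Require Import structures.
From mathcomp Require Import all_boot all_order all_algebra.
From mathcomp Require Import all_classical all_reals all_analysis.
Set Implicit Arguments. Unset Strict Implicit. Unset Printing Implicit Defensive.
Import Order.TTheory GRing.Theory Num.Theory.
Import numFieldNormedType.Exports.
Local Open Scope classical_set_scope.
Local Open Scope ring_scope.

Definition slowly_varying (R : realType) (l : R -> R) : Prop :=
  forall lam : R, 0 < lam -> (fun x => l (lam * x) / l x) @ +oo --> (1 : R).

(* mutual independence of the sequence X: product rule for the events
   {X_i in B_i}, i < n, for every n and Borel sets B_i (taking B_i = setT
   gives every finite subfamily) *)
Definition mutually_independent d (T : measurableType d) (R : realType)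
    (P : probability T R) (X : nat -> T -> R) : Prop :=
  forall (n : nat) (B : nat -> set R), (forall i, measurable (B i)) ->
    P (\big[setI/setT]_(i < n) (X i @^-1` B i)) =
    (\prod_(i < n) P (X i @^-1` B i))%E.

Definition identically_distributed d (T : measurableType d) (R : realType)
    (P : probability T R) (X : nat -> T -> R) : Prop :=
  forall (i : nat) (B : set R), measurable B ->
    P (X i @^-1` B) = P (X 0%N @^-1` B).

(* i.i.d. nonnegative real random variables xi_1, xi_2, ... (indexed from 0) *)
Definition iid_nonneg d (T : measurableType d) (R : realType)
    (P : probability T R) (X : nat -> T -> R) : Prop :=
  [/\ forall i, measurable_fun setT (X i),
      forall i t, 0 <= X i t,
      identically_distributed P X &
      mutually_independent P X].

Definition tailF d (T : measurableType d) (R : realType)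
    (P : probability T R) (X : nat -> T -> R) (x : R) : R :=
  fine (P [set t | x <= X 0%N t]).

Definition partial_sum d (T : measurableType d) (R : realType)
    (X : nat -> T -> R) (n : nat) (t : T) : R :=
  \sum_(i < n) X i t.

Definition tailFn d (T : measurableType d) (R : realType)
    (P : probability T R) (X : nat -> T -> R) (n : nat) (x : R) : R :=
  fine (P [set t | x <= partial_sum X n t]).

Definition Gint d (T : measurableType d) (R : realType)
    (P : probability T R) (X : nat -> T -> R) (x : R) : R :=
  fine (\int[lebesgue_measure]_(t in [set` `[0, x]%R]) (tailF P X t)%:E)%E.

(* Main.v *)
(* The exponent one makes second moments suffice. Let G(z) = E min(X, z). Since
   F(2z) ~ F(z) / 2, a dyadic argument gives E min(X, z)^2 <= C z^2 F(z), so by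
   Chebyshev the sum of the truncated variables min(X_i, z) deviates from n G(z)
   by at least r with probability at most C (z / r)^2 n F(z). If y >= c n G(y),
   then n F(y) -> 0 because y F(y) = o(G(y)). Hence, to reach n G(y) + a y, the sum
   must make one jump of size about a y (probability about n F(a y)), the others
   staying within o(y) of n G(y); the truncation at k y costs at most a
   multiple of k n F(y), with k small. This holds uniformly in y >= c n G(y) and
   in a in a compact subset of (0, oo), which is (b). Part (a) follows with
   a = 1 - n G(y) / y; conversely, if x_n / (n G(x_n)) does not tend to infinity,
   the uniform estimate with a = 1 contradicts the asymptotics at a point
   y >= x_n with y of order n G(y), where n F(y) is not equivalent to
   n F(y + n G(y)). Part (c) is Chebyshev with E min(X, z)^2 <= z G(z).
   Independence enters only through the events X_i >= t, since min(X, z) is a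
   uniform limit of combinations of their indicators. *)
Require Import Defs.
From HB Require Import structures.
From mathcomp Require Import all_boot all_order all_algebra.
From mathcomp Require Import all_classical all_reals all_analysis.
From mathcomp Require Import measurable_realfun ring lra zify.
Import Order.TTheory GRing.Theory Num.Theory.
Import numFieldNormedType.Exports.
Local Open Scope classical_set_scope.
Local Open Scope ring_scope.

(** * Regularly varying tails of index one *)

(** The last clause is regular variation of index -1, [F (lam * x) / F x] tending to [lam^-1],
    multiplied out so that linear arithmetic applies to it directly. *)
Definition regular_tail (R : realType) (F : R -> R) : Prop :=
  [/\ forall x, 0 < F x, forall x, F x <= 1,
      forall x y, x <= y -> F y <= F x &
      forall lam eps : R, 0 < lam -> 0 < eps -> exists M : R,
        forall x, M <= x -> `|lam * F (lam * x) - F x| <= eps * F x].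

(** These increment bounds are the only properties of the integral of a nonincreasing function that
    are used below. They fit both [Gint] and, for the indicator of [t <= x], the function
    [min x t]. *)
Definition is_primitive (R : realType) (F G : R -> R) : Prop :=
  G 0 = 0 /\ forall v w, 0 <= v -> v <= w ->
    (w - v) * F w <= G w - G v /\ G w - G v <= (w - v) * F v.

Section RegularTail.
Context {R : realType} {F G : R -> R}.
Hypothesis rF : regular_tail R F.
Hypothesis pG : is_primitive R F G.

Lemma tail_gt0 x : 0 < F x. Proof. by case: rF. Qed.
Lemma tail_le1 x : F x <= 1. Proof. by case: rF. Qed.
Lemma tail_ni x y : x <= y -> F y <= F x. Proof. by case: rF => _ _ h _; exact: h. Qed.

Lemma tail_scale_le (lam k : R) : 0 < lam -> lam^-1 < k ->
  exists2 M : R, 0 < M & forall x, M <= x -> F (lam * x) <= k * F x.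
Proof.
move=> lam0 hk; have [_ _ _ rv] := rF.
have e0 : 0 < lam * k - 1 by rewrite subr_gt0 mulrC -ltr_pdivrMr ?div1r.
have [M HM] := rv _ _ lam0 e0; exists (Num.max 1 M).
  by rewrite lt_max ltr01.
move=> x; rewrite ge_max => /andP[_ /HM]; rewrite ler_norml => /andP[_ h].
rewrite -(ler_pM2l lam0); lra.
Qed.

Lemma tail_scale_ge (lam k : R) : 0 < lam -> k < lam^-1 ->
  exists2 M : R, 0 < M & forall x, M <= x -> k * F x <= F (lam * x).
Proof.
move=> lam0 hk; have [_ _ _ rv] := rF.
have e0 : 0 < 1 - lam * k by rewrite subr_gt0 mulrC -ltr_pdivlMr ?div1r.
have [M HM] := rv _ _ lam0 e0; exists (Num.max 1 M).
  by rewrite lt_max ltr01.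
move=> x; rewrite ge_max => /andP[_ /HM]; rewrite ler_norml => /andP[h _].
rewrite -(ler_pM2l lam0); lra.
Qed.

Lemma prim0 : G 0 = 0. Proof. by case: pG. Qed.

Lemma prim_ge v w : 0 <= v -> v <= w -> (w - v) * F w <= G w - G v.
Proof. by case: pG => _ h v0 vw; case: (h _ _ v0 vw). Qed.

Lemma prim_le v w : 0 <= v -> v <= w -> G w - G v <= (w - v) * F v.
Proof. by case: pG => _ h v0 vw; case: (h _ _ v0 vw). Qed.

Lemma prim_nd v w : 0 <= v -> v <= w -> G v <= G w.
Proof.
move=> v0 vw; have := prim_ge _ _ v0 vw; have := tail_gt0 w.
have : 0 <= w - v by lra.
nra.
Qed.

Lemma prim_lower v : 0 <= v -> v * F v <= G v.
Proof. by move=> v0; have := prim_ge _ _ (lexx 0) v0; rewrite prim0 !subr0. Qed.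

Lemma prim_upper v : 0 <= v -> G v <= v.
Proof.
move=> v0; have := prim_le _ _ (lexx 0) v0; have := tail_le1 0.
rewrite prim0 !subr0; nra.
Qed.

Lemma prim_gt0 v : 0 < v -> 0 < G v.
Proof.
move=> v0; apply: lt_le_trans (prim_lower _ (ltW v0)).
exact: mulr_gt0 v0 (tail_gt0 v).
Qed.

Lemma prim_ge0 v : 0 <= v -> 0 <= G v.
Proof. by move=> v0; rewrite -prim0 prim_nd. Qed.

(* Concavity of [G]: the ratio [x / G x] is nondecreasing. *)
Lemma prim_ratio v w : 0 <= v -> v <= w -> v * G w <= w * G v.
Proof.
move=> v0 vw; have := prim_le _ _ v0 vw; have := prim_lower _ v0; nra.
Qed.

(** This is Karamata's theorem at the critical index: [G y >= G (y / 2) + (y / 2) * F y], while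
    [(y / 2) * F (y / 2)] is close to [y * F y]. Each doubling of the scale thus adds almost 1/2 to
    the constant, and the induction on [k] claims only 1/4. *)
Lemma prim_dominates_tail (K : R) :
  exists2 M : R, 0 < M & forall y, M <= y -> K * (y * F y) <= G y.
Proof.
suff Hk : forall k : nat, exists2 M : R, 0 < M &
    forall y, M <= y -> (k%:R / 4) * (y * F y) <= G y.
  pose k := Num.truncn (4 * `|K|); have [M M0 HM] := Hk k.+1; exists M => // y yM.
  have y0 : 0 <= y by apply: le_trans yM; exact: ltW.
  apply: le_trans (HM _ yM); apply: ler_wpM2r.
    by rewrite mulr_ge0// ltW// tail_gt0.
  have : 4 * `|K| < k.+1%:R by exact: truncnS_gt.
  have := ler_norm K; lra.
elim=> [|k [M M0 IH]].
  exists 1 => // y y1; rewrite !mul0r prim_ge0//; lra.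
have k0 : 0 <= k%:R :> R by [].
(* The factor is [2 - 1 / (k + 1)]; using it in place of the limit 2 costs less than 1/8 of the 1/2
   gained. *)
have k2 : (2 * k%:R + 1) / (k%:R + 1) < (2^-1 : R)^-1.
  by rewrite invrK ltr_pdivrMr; lra.
have [M2 M20 HM2] := tail_scale_ge (2^-1) _ ltac:(lra) k2.
exists (2 * M + M2); first lra.
move=> y yM; have yM2 : M2 <= y by lra.
have h1 : M <= 2^-1 * y by lra.
have := IH _ h1; have := HM2 _ yM2.
have := prim_ge (2^-1 * y) y ltac:(lra) ltac:(lra).
move: (F (2^-1 * y)) (F y) (tail_gt0 y) (G y) (G (2^-1 * y)) => f1 f2 f20 g1 g2 h2.
have -> : (2 * k%:R + 1) / (k%:R + 1) * f2 = (2 * k%:R + 1) * f2 / (k%:R + 1) by ring.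
rewrite ler_pdivrMr; last lra.
rewrite -[k.+1%:R]natr1.
move: (k%:R) k0 => K' k0 h3 h4.
have h5 : K' * ((2 * K' + 1) * f2) <= K' * (f1 * (K' + 1)) by exact: ler_wpM2l.
have y0 : 0 < y by lra.
suff : ((K' + 1) / 4) * f2 <= K' / 8 * f1 + f2 / 2.
  by move=> h; have := ler_wpM2l (ltW y0) h; lra.
nra.
Qed.

(** Decay of the tail comes from [e^-1 * (M * F M) <= G M <= M]. *)
Lemma tail_small (e : R) : 0 < e -> exists2 M : R, 0 < M & F M <= e.
Proof.
move=> e0; have [M M0 HM] := prim_dominates_tail e^-1; exists M => //.
have := HM _ (lexx M); have := prim_upper _ (ltW M0).
have ei0 : 0 < e^-1 by rewrite invr_gt0.
have h0 : e * e^-1 = 1 by rewrite divff// gt_eqF.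
move=> h1 h2; have h3 : M * (e^-1 * F M) <= M * 1 by lra.
rewrite ler_pM2l// in h3; rewrite -(ler_pM2l ei0); lra.
Qed.

Lemma prim_sublinear (e : R) : 0 < e ->
  exists2 M : R, 0 < M & forall y, M <= y -> G y <= e * y.
Proof.
move=> e0; have [M M0 HM] := tail_small (e / 2) ltac:(lra).
exists (M + 2 * M / e) => [|y yM].
  by rewrite addr_gt0// divr_gt0// mulr_gt0.
have : 0 < 2 * M / e by rewrite divr_gt0// mulr_gt0.
move=> h0; have My : M <= y by lra.
have := prim_le _ _ (ltW M0) My; have := prim_upper _ (ltW M0).
have : 2 * M / e <= y by lra.
rewrite ler_pdivrMr// => h1 h2 h3.
have : (y - M) * F M <= (y - M) * (e / 2) by rewrite ler_wpM2l// subr_ge0.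
nra.
Qed.

(** Since [y / G y] is nondecreasing, a point [y] below a fixed level has [y / G y] bounded, which
    excludes [c * n <= y / G y] for large [n]. Estimates valid for large [y] thereby become
    estimates valid for large [n], uniformly in [y]. *)
Lemma scale_eventually_large (c M : R) : 0 < c ->
  exists N : nat, forall n y, (N <= n)%N -> 0 < y -> c * n%:R * G y <= y -> M <= y.
Proof.
move=> c0; pose m := Num.max 1 M.
have m1 : 1 <= m by rewrite /m le_max lexx.
have mM : M <= m by rewrite /m le_max lexx orbT.
have gm := prim_gt0 m ltac:(lra).
pose q := m / (c * G m).
exists (Num.truncn q).+1 => n y Nn y0 hy; rewrite (le_trans mM)// leNgt; apply/negP => ym.
have qn : q < n%:R by apply: lt_le_trans (truncnS_gt q) _; rewrite ler_nat.
have := prim_ratio _ _ (ltW y0) (ltW ym).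
move: qn; rewrite /q ltr_pdivrMr ?mulr_gt0// => qn h.
have gy := prim_gt0 y y0.
have : m * G y < n%:R * (c * G m) * G y by rewrite ltr_pM2r.
have : c * n%:R * G y * G m <= y * G m by rewrite ler_pM2r.
lra.
Qed.

(* At index one the truncated second moment is governed by its top scale; the
   hypotheses on [V] are those satisfied by [p E (min X z)^2]. *)
Lemma truncated_moment_bound : exists C z0 : R, [/\ 0 < C, 0 < z0 &
  forall (V : R -> R) (p : R), 0 <= p ->
    (forall z, 0 <= z -> V z <= p * z ^+ 2) ->
    (forall z, 0 <= z -> V (2 * z) <= V z + p * (4 * z ^+ 2 * F z)) ->
    forall z, z0 <= z -> V z <= p * (C * z ^+ 2 * F z)].
Proof.
have [M M0 HM] := tail_scale_ge 2 (3 / 8) ltac:(lra) ltac:(lra).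
(* The recursion gives [V w <= p * (C / 4 + 1) * w ^+ 2 * F (w / 2)], and [C / 4 + 1 <= 3 / 8 * C]
   once [C >= 8]. The other term of the maximum starts the induction: [C * F w >= 1] for
   [w <= 2 * M]. *)
pose C := Num.max 8 (F (2 * M))^-1; exists C, M.
have C8 : 8 <= C by rewrite /C le_max lexx.
have CF : 1 <= C * F (2 * M).
  rewrite -ler_pdivrMr ?tail_gt0// div1r /C le_max lexx orbT//.
split => //; first lra.
move=> V p p0 V1 V2 z zM.
suff H : forall k : nat, forall w, M <= w -> w <= 2 ^+ k * (2 * M) ->
    V w <= p * (C * w ^+ 2 * F w).
  apply: (H (Num.truncn (z / M)).+1) => //.
  have h1 : z / M < (Num.truncn (z / M)).+1%:R by exact: truncnS_gt.
  move: h1; rewrite ltr_pdivrMr// => /ltW/le_trans; apply.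
  have h2 : (Num.truncn (z / M)).+1%:R <= 2 ^+ (Num.truncn (z / M)).+1 :> R.
    by rewrite -natrX ler_nat ltnW// ltn_expl.
  have := ler_wpM2r (ltW M0) h2.
  have : 0 <= (2 ^+ (Num.truncn (z / M)).+1 : R) by exact: exprn_ge0.
  nra.
elim=> [w wM|k IH w wM].
  rewrite expr0 mul1r => w2; apply: le_trans (V1 w _) _; first lra.
  have C0 : 0 <= C by lra.
  have h1 : 1 <= C * F w by apply: le_trans CF (ler_wpM2l C0 (tail_ni _ _ w2)).
  have pw : 0 <= p * w ^+ 2 by rewrite mulr_ge0// sqr_ge0.
  have := ler_wpM2l pw h1; move: (w ^+ 2) (F w) => w' f1; lra.
rewrite exprS -mulrA => wk.
have [w2|w2] := leP w (2 * M).
  apply: IH => //; have : 1 <= 2 ^+ k :> R by rewrite exprn_ege1//; lra.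
  nra.
have := IH (w / 2) ltac:(lra) ltac:(lra).
have := V2 (w / 2) ltac:(lra); have := HM (w / 2) ltac:(lra).
rewrite (_ : 2 * (w / 2) = w); last lra.
have -> : (w / 2) ^+ 2 = w ^+ 2 / 4 by rewrite expr_div_n; congr (_ / _); lra.
have pw : 0 <= p * w ^+ 2 by rewrite mulr_ge0// sqr_ge0.
have := tail_gt0 (w / 2); have := tail_gt0 w.
move: (w ^+ 2) (F (w / 2)) (F w) pw => w' f1 f2 pw f20 f10 h1 h2 h3.
apply: (le_trans h2); apply: (le_trans (lerD h3 (lexx _))).
suff : C * (1 / 4) * f1 + f1 <= C * f2 by move=> h; have := ler_wpM2l pw h; lra.
nra.
Qed.

End RegularTail.

(** * Expectation of bounded functions *)

(** Boundedness makes the class stable under products, so integrability is automatic in the second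
    moment computations. *)
Definition bounded_mfun d (T : measurableType d) (R : realType) (f : T -> R) :=
  measurable_fun setT f /\ exists M, forall t, `|f t| <= M.

Section BoundedExpectation.
Context {d : measure_display} {T : measurableType d} {R : realType}.
Variable P : probability T R.
Implicit Types (f g : T -> R) (A B : set T).

Local Notation bmf := (@bounded_mfun d T R).
Local Notation EE f := (Rintegral P setT f).
Local Notation pr A := (fine (P A)).

Lemma bmf_integrable f : bmf f -> P.-integrable setT (EFin \o f).
Proof.
move=> [mf [M HM]]; apply: measurable_bounded_integrable => //.
  exact: le_lt_trans (probability_le1 P measurableT) (ltry 1).
by exists M; split; [exact: num_real|move=> y My t _ /=; exact: le_trans (HM t) (ltW My)].
Qed.

Lemma bmf_cst c : bmf (cst c).
Proof. by split; [exact: measurable_cst|exists `|c|]. Qed.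

Lemma bmfD f g : bmf f -> bmf g -> bmf (fun t => f t + g t).
Proof.
move=> [mf [M HM]] [mg [N HN]]; split; first exact: measurable_funD.
by exists (M + N) => t; rewrite (le_trans (ler_normD _ _))// lerD.
Qed.

Lemma bmfM f g : bmf f -> bmf g -> bmf (fun t => f t * g t).
Proof.
move=> [mf [M HM]] [mg [N HN]]; split; first exact: measurable_funM.
by exists (M * N) => t; rewrite normrM ler_pM.
Qed.

Lemma bmfZ c f : bmf f -> bmf (fun t => c * f t).
Proof. exact/bmfM/bmf_cst. Qed.

Lemma bmfB f g : bmf f -> bmf g -> bmf (fun t => f t - g t).
Proof.
move=> [mf [M HM]] [mg [N HN]]; split; first exact: measurable_funB.
by exists (M + N) => t; rewrite (le_trans (ler_normB _ _))// lerD.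
Qed.

Lemma bmf_sum (I : Type) (r : seq I) (Q : pred I) (f : I -> T -> R) :
  (forall i, Q i -> bmf (f i)) -> bmf (fun t => \sum_(i <- r | Q i) f i t).
Proof.
move=> bf; elim: r => [|i r IH].
  rewrite (_ : (fun _ => _) = cst 0); first exact: bmf_cst.
  by apply/funext => t /=; rewrite big_nil.
have [Qi|/negbTE Qi] := boolP (Q i).
  rewrite (_ : (fun _ => _) = fun t => f i t + \sum_(j <- r | Q j) f j t).
    exact: bmfD (bf _ Qi) IH.
  by apply/funext => t /=; rewrite big_cons Qi.
rewrite (_ : (fun _ => _) = fun t => \sum_(j <- r | Q j) f j t)//.
by apply/funext => t /=; rewrite big_cons Qi.
Qed.

Lemma bmf_indic A : measurable A -> bmf \1_A.
Proof.
move=> mA; split; first exact: measurable_indic.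
by exists 1 => t; rewrite indicE; case: (t \in A); rewrite ?normr0 ?normr1.
Qed.

Lemma expD f g : bmf f -> bmf g -> EE (fun t => f t + g t) = EE f + EE g.
Proof. by move=> bf bg; rewrite RintegralD//; exact: bmf_integrable. Qed.

Lemma expB f g : bmf f -> bmf g -> EE (fun t => f t - g t) = EE f - EE g.
Proof. by move=> bf bg; rewrite RintegralB//; exact: bmf_integrable. Qed.

Lemma expZ c f : bmf f -> EE (fun t => c * f t) = c * EE f.
Proof. by move=> bf; rewrite RintegralZl//; exact: bmf_integrable. Qed.

Lemma exp_cst c : EE (fun=> c) = c.
Proof.
rewrite Rintegral_cst//; have := @probability_setT _ _ _ P.
by move=> /= ->; rewrite mulr1.
Qed.

Lemma exp_sum (I : Type) (r : seq I) (Q : pred I) (f : I -> T -> R) :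
  (forall i, Q i -> bmf (f i)) ->
  EE (fun t => \sum_(i <- r | Q i) f i t) = \sum_(i <- r | Q i) EE (f i).
Proof.
move=> bf; elim: r => [|i r IH].
  rewrite big_nil (_ : (fun _ => _) = cst 0) ?exp_cst//.
  by apply/funext => t /=; rewrite big_nil.
rewrite big_cons; case: ifPn => Qi.
  rewrite -IH -expD; [|exact: bf|exact: bmf_sum].
  by apply: eq_Rintegral => t _; rewrite big_cons Qi.
by rewrite -IH; apply: eq_Rintegral => t _; rewrite big_cons (negbTE Qi).
Qed.

Lemma exp_le f g : bmf f -> bmf g -> (forall t, f t <= g t) -> EE f <= EE g.
Proof. by move=> bf bg fg; apply: le_Rintegral => //; exact: bmf_integrable. Qed.

Lemma exp_indic A : measurable A -> EE \1_A = pr A.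
Proof. by move=> mA; rewrite /Rintegral integral_indic// setIT. Qed.

Lemma exp_indicM A f c : measurable A -> bmf f -> (forall t, f t <= c) ->
  EE (fun t => \1_A t * f t) <= pr A * c.
Proof.
move=> mA bf fc; rewrite -exp_indic// mulrC -expZ; last exact: bmf_indic.
apply: exp_le; [exact/bmfM/bf/bmf_indic|exact/bmfZ/bmf_indic|].
by move=> t; rewrite mulrC ler_wpM2r// indicE.
Qed.

Lemma pr_ge0 A : 0 <= pr A. Proof. exact: fine_ge0. Qed.

Lemma pr_le1 A : measurable A -> pr A <= 1.
Proof.
move=> mA; rewrite -[1]/(fine 1%:E) fine_le// ?fin_num_measure//.
exact: probability_le1.
Qed.

Lemma pr_le A B : measurable A -> measurable B -> A `<=` B -> pr A <= pr B.
Proof.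
by move=> mA mB AB; rewrite fine_le ?fin_num_measure// le_measure// inE.
Qed.

Lemma pr_leU A B C : measurable A -> measurable B -> measurable C ->
  A `<=` B `|` C -> pr A <= pr B + pr C.
Proof.
move=> mA mB mC ABC; rewrite -!exp_indic// -expD; try exact: bmf_indic.
apply: exp_le; [exact: bmf_indic|exact: bmfD (bmf_indic _ mB) (bmf_indic _ mC)|].
move=> t; rewrite !indicE; case: (boolP (t \in A)) => [/set_mem At|_]; last exact: addr_ge0.
case: (ABC _ At) => h.
  by rewrite (mem_set h) lerDl.
by rewrite (mem_set h) lerDr.
Qed.

Lemma pr_le_bigcup n A (B : 'I_n -> set T) : measurable A ->
  (forall i, measurable (B i)) -> (forall t, A t -> exists i, B i t) ->
  pr A <= \sum_(i < n) pr (B i).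
Proof.
move=> mA mB AB; under eq_bigr do rewrite -exp_indic//.
rewrite -exp_indic// -exp_sum => [|i _]; last exact: bmf_indic.
apply: exp_le; [exact: bmf_indic|by apply: bmf_sum => i _; exact: bmf_indic|].
move=> t; rewrite [leLHS]indicE; case: (boolP (t \in A)) => [/set_mem /AB[i Bi]|_].
  by rewrite (bigD1 i)//= indicE (mem_set Bi) lerDl sumr_ge0.
by apply: sumr_ge0 => j _; rewrite indicE.
Qed.

(* With [K] the number of events [E i] that occur, [2 K - K ^ 2 = 1 - (K - 1) ^ 2]
   is at most one and vanishes when [K = 0]. *)
Lemma pr_ge_bonferroni n A (E : 'I_n -> set T) : measurable A ->
  (forall i, measurable (E i)) -> (forall i, E i `<=` A) ->
  \sum_(i < n) pr (E i) - \sum_(i < n) \sum_(j < n | j != i) pr (E i `&` E j)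
    <= pr A.
Proof.
move=> mA mE EA.
have bI i := bmf_indic _ (mE i).
pose K t := \sum_(i < n) \1_(E i) t : R.
have bK : bmf K by apply: bmf_sum.
have -> : \sum_(i < n) pr (E i) = EE K.
  by rewrite exp_sum//; apply: eq_bigr => i _; rewrite exp_indic.
pose D t := \sum_(i < n) \sum_(j < n | j != i) (\1_(E i `&` E j) t : R).
have bD : bmf D.
  apply: bmf_sum => i _; apply: bmf_sum => j _; apply: bmf_indic.
  exact: measurableI.
have -> : \sum_(i < n) \sum_(j < n | j != i) pr (E i `&` E j) = EE D.
  rewrite exp_sum => [|i _]; last first.
    by apply: bmf_sum => j _; apply: bmf_indic; exact: measurableI.
  apply: eq_bigr => i _; rewrite exp_sum => [|j _]; last first.
    by apply: bmf_indic; exact: measurableI.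
  by apply: eq_bigr => j _; rewrite exp_indic//; exact: measurableI.
rewrite -expB// -exp_indic//; apply: exp_le; [exact: bmfB|exact: bmf_indic|].
(* [D] counts the ordered pairs of distinct events that occur; each unordered pair is counted
   twice. *)
move=> t; have -> : D t = K t ^+ 2 - K t.
  rewrite expr2 {1}/K mulr_suml /K /D -sumrB; apply: eq_bigr => i _.
  have -> : \1_(E i) t * \sum_(j < n) \1_(E j) t =
      \1_(E i) t + \sum_(j < n | j != i) \1_(E i `&` E j) t :> R.
    rewrite mulr_sumr (bigD1 i)//=; congr (_ + _).
      by rewrite indicE; case: (t \in E i); rewrite ?mulr0 ?mulr1.
    by apply: eq_bigr => j _; rewrite indicI.
  by rewrite addrC addKr.
rewrite [leRHS]indicE; case: (boolP (t \in A)) => [_|tA] /=.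
  have := sqr_ge0 (K t - 1); rewrite !expr2; lra.
suff -> : K t = 0 by rewrite expr0n !subr0.
rewrite /K big1// => i _; rewrite indicE; case: (boolP (t \in E i)) => // /set_mem/EA h.
by rewrite (mem_set h) in tA.
Qed.

End BoundedExpectation.

(** In each cell the right-endpoint sum falls short by at most [h] times the drop of [F] across that
    cell, and these drops telescope. *)
Lemma riemann_sum (R : realType) (F G : R -> R) (h : R) (N : nat) :
  is_primitive R F G -> (forall x, 0 <= F x <= 1) -> 0 <= h ->
  `|G (N%:R * h) - \sum_(m < N) h * F (m.+1%:R * h)| <= h.
Proof.
move=> [G0 pG] F01 h0.
suff : 0 <= G (N%:R * h) - \sum_(m < N) h * F (m.+1%:R * h) <=
    h * (F 0 - F (N%:R * h)).
  move=> /andP[h1 h2]; rewrite ger0_norm//; apply: (le_trans h2).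
  have := F01 0; have := F01 (N%:R * h) => /andP[? _] /andP[_ ?].
  by rewrite -[leRHS]mulr1 ler_wpM2l//; lra.
elim: N => [|N /andP[IH1 IH2]].
  by rewrite big_ord0 mul0r G0 !subrr mulr0 lexx.
have NN : N.+1%:R * h = N%:R * h + h by rewrite -natr1 mulrDl mul1r.
have [] := pG (N%:R * h) (N.+1%:R * h) ltac:(exact: mulr_ge0) ltac:(rewrite NN; lra).
have -> : N.+1%:R * h - N%:R * h = h by rewrite NN; ring.
by rewrite big_ord_recr /= => h1 h2; apply/andP; split; lra.
Qed.

(** Through [riemann_sum], this discretizes a truncated variable at the same nodes as [Gint]. *)
Lemma min_primitive (R : realType) (x : R) : 0 <= x ->
  is_primitive R (fun t => (t <= x)%R%:R) (fun t => Num.min x t).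
Proof.
move=> x0; split; first by rewrite min_r.
move=> v w v0 vw; rewrite /Num.min.
by case: (ltP x w); case: (ltP x v) => /= h1 h2; split; lra.
Qed.

(** * Truncated sums of i.i.d. variables *)

Section IidSequence.
Context {d : measure_display} {T : measurableType d} {R : realType}.
Variables (P : probability T R) (X : nat -> T -> R).
Hypothesis iidX : iid_nonneg P X.

Local Notation EE f := (Rintegral P setT f).
Local Notation pr A := (fine (P A)).
Local Notation F := (tailF P X).
Local Notation G := (Gint P X).

Definition exceed (i : nat) (t : R) : set T := [set w | t <= X i w].

Lemma X_measurable i : measurable_fun setT (X i). Proof. by case: iidX. Qed.

Lemma X_ge0 i w : 0 <= X i w. Proof. by case: iidX. Qed.

Lemma exceed_preimage i t : exceed i t = X i @^-1` `[t, +oo[%classic.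
Proof. by apply/seteqP; split => w /=; rewrite in_itv/= andbT. Qed.

Lemma measurable_exceed i t : measurable (exceed i t).
Proof.
rewrite exceed_preimage -[X in measurable X]setTI.
by apply: X_measurable => //; exact: measurable_itv.
Qed.

Lemma pr_exceed i t : pr (exceed i t) = F t.
Proof.
have [_ _ idX _] := iidX.
rewrite exceed_preimage idX; last exact: measurable_itv.
by rewrite -exceed_preimage.
Qed.

Lemma exceed0 i t : t <= 0 -> exceed i t = setT.
Proof. by move=> t0; apply/seteqP; split => // w _; exact: le_trans (X_ge0 i w). Qed.

Lemma tailF01 x : 0 <= F x <= 1.
Proof. by rewrite -(pr_exceed 0) pr_ge0 pr_le1//; exact: measurable_exceed. Qed.

Lemma tailF_ni x y : x <= y -> F y <= F x.
Proof.
move=> xy; rewrite -!(pr_exceed 0); apply: pr_le; try exact: measurable_exceed.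
by move=> w; exact: le_trans.
Qed.

Lemma tailF_le0 x : x <= 0 -> F x = 1.
Proof.
move=> x0; rewrite -(pr_exceed 0) exceed0//.
by have := @probability_setT _ _ _ P => /= ->.
Qed.

Lemma Gint_primitive : is_primitive R F G.
Proof.
have intF (i : interval R) : (lebesgue_measure [set` i] < +oo)%E ->
    lebesgue_measure.-integrable [set` i] (EFin \o F).
  move=> ifin; apply: measurable_bounded_integrable => //.
    by apply: nonincreasing_measurable => // x y; exact: tailF_ni.
  exists 1; split; first exact: num_real.
  move=> y y1 t _ /=; have /andP[F0 F1] := tailF01 t.
  by rewrite ger0_norm// (le_trans F1)// ltW.
have fin (a b : R) : (lebesgue_measure [set` `[a, b]%R] < +oo)%E.
  by rewrite lebesgue_measure_itv; case: ifP => _; rewrite ltry.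
have fino (a b : R) : (lebesgue_measure [set` `]a, b]%R] < +oo)%E.
  by rewrite lebesgue_measure_itv; case: ifP => _; rewrite ltry.
split.
  rewrite /Gint (_ : [set` `[0, 0]%R] = [set (0 : R)]) ?integral_set1//.
  exact: set_itv1.
move=> v w v0 vw.
have -> : G w - G v = Rintegral lebesgue_measure [set` `]v, w]%R] F.
  rewrite -(@Rintegral_itvB _ _ (BLeft 0) (BRight w) v)//; apply: intF; exact: fin.
have mI : (w - v) = fine (lebesgue_measure [set` `]v, w]%R]).
  rewrite lebesgue_measure_itv /= lte_fin; case: ltP => //= wv.
  by apply/eqP; rewrite subr_eq0 eq_le vw wv.
have cI c : lebesgue_measure.-integrable [set` `]v, w]%R] (EFin \o (fun=> c : R)).
  apply: measurable_bounded_integrable => //; first exact: fino.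
  exists `|c|; split => // y y1 t _ /=; exact: ltW.
rewrite mI ![_ * F _]mulrC; split; rewrite -Rintegral_cst//;
  apply: le_Rintegral => //; try (by apply: intF; exact: fino); move=> x /=;
  by rewrite in_itv /= => /andP[vx xw]; apply: tailF_ni => //; exact: ltW.
Qed.

(** * Independence of exceedance events *)

Lemma exceed_indep3 i j k s t u : i != j -> i != k -> j != k ->
  pr (exceed i s `&` exceed j t `&` exceed k u) = F s * F t * F u.
Proof.
move=> ij ik jk; have [_ _ _ indX] := iidX.
(* The product rule is available for initial segments of indices only, so the whole line is put at
   every other index. *)
pose B (m : nat) : set R := if m == i then `[s, +oo[%classic
  else if m == j then `[t, +oo[%classic
  else if m == k then `[u, +oo[%classic else setT.
have mB m : measurable (B m).
  by rewrite /B; do 3?[case: ifP => _]; try exact: measurable_itv.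
pose n := (maxn i (maxn j k)).+1.
have iltn : (i < n)%N by rewrite /n ltnS leq_max leqnn.
have jltn : (j < n)%N by rewrite /n ltnS !leq_max leqnn orbT.
have kltn : (k < n)%N by rewrite /n ltnS !leq_max leqnn !orbT.
have Bi : X i @^-1` B i = exceed i s by rewrite /B eqxx exceed_preimage.
have Bj : X j @^-1` B j = exceed j t.
  by rewrite /B eq_sym (negbTE ij) eqxx exceed_preimage.
have Bk : X k @^-1` B k = exceed k u.
  by rewrite /B eq_sym (negbTE ik) eq_sym (negbTE jk) eqxx exceed_preimage.
have Bm m : m != i -> m != j -> m != k -> X m @^-1` B m = setT.
  by move=> mi mj mk; rewrite /B (negbTE mi) (negbTE mj) (negbTE mk).
have -> : exceed i s `&` exceed j t `&` exceed k u =
    \big[setI/setT]_(m < n) (X m @^-1` B m).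
  rewrite -(bigcap_mkord n (fun m => X m @^-1` B m)); apply/seteqP; split => w.
    move=> [[h1 h2] h3] m _.
    have [->|mi] := eqVneq m i; first by rewrite Bi.
    have [->|mj] := eqVneq m j; first by rewrite Bj.
    have [->|mk] := eqVneq m k; first by rewrite Bk.
    by rewrite Bm.
  by move=> h; rewrite -Bi -Bj -Bk; split; [split|]; exact: h.
rewrite indX// (bigD1 (Ordinal iltn))//= (bigD1 (Ordinal jltn)); last first.
  by rewrite -val_eqE /= eq_sym.
rewrite (bigD1 (Ordinal kltn)) /=; last first.
  by rewrite -!val_eqE /= eq_sym ik eq_sym jk.
rewrite big1 ?mule1 ?Bi ?Bj ?Bk; last first.
  move=> m; rewrite -!val_eqE /= => /andP[/andP[mi mj] mk].
  by rewrite Bm//; exact: probability_setT.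
rewrite !fineM ?fin_num_measure//; try exact: measurable_exceed.
  by rewrite !pr_exceed mulrA.
by rewrite fin_numM// fin_num_measure//; exact: measurable_exceed.
Qed.

Lemma exceed_indep2 i j s t : i != j ->
  pr (exceed i s `&` exceed j t) = F s * F t.
Proof.
(* A fresh third index with level 0 gives a sure event, the variables being nonnegative. *)
move=> ij; pose k := (maxn i j).+1.
have := @exceed_indep3 i j k s t 0 ij _ _.
rewrite (exceed0 k 0 (lexx _)) setIT (tailF_le0 0 (lexx _)) mulr1; apply.
  by rewrite neq_ltn /k ltnS leq_maxl.
by rewrite neq_ltn /k ltnS leq_maxr.
Qed.

(** This is the amount of independence that a second moment bound restricted to [A] requires. It
    serves for the sure event, and for a jump of one variable [i], with [Q] then selecting the other
    indices. *)
Definition indep_of (A : set T) (Q : pred nat) : Prop :=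
  [/\ measurable A,
      forall j s, Q j -> pr (A `&` exceed j s) = pr A * F s &
      forall j k s t, Q j -> Q k -> j != k ->
        pr (A `&` exceed j s `&` exceed k t) = pr A * F s * F t].

Lemma indep_of_setT : indep_of setT predT.
Proof.
have P1 : pr setT = 1 by have := @probability_setT _ _ _ P => /= ->.
split => // [j s _|j k s t _ _ jk]; rewrite setTI P1 mul1r.
  exact: pr_exceed.
exact: exceed_indep2.
Qed.

Lemma indep_of_exceed i s : indep_of (exceed i s) (fun j => j != i).
Proof.
split; first exact: measurable_exceed.
  by move=> j t ji; rewrite exceed_indep2 1?eq_sym// pr_exceed.
by move=> j k t u ji ki jk; rewrite exceed_indep3 1?eq_sym// 1?eq_sym// pr_exceed.
Qed.

(** * Expectations of truncated variables *)

Lemma bmf_exceed i t : bounded_mfun d T R \1_(exceed i t).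
Proof. exact/bmf_indic/measurable_exceed. Qed.

Lemma bmf_trunc k z : 0 <= z -> bounded_mfun d T R (fun w => Num.min (X k w) z).
Proof.
move=> z0; split.
  by apply: measurable_minr; [exact: X_measurable|exact: measurable_cst].
exists z => w; rewrite ger0_norm ?le_min ?X_ge0//.
by rewrite ge_min lexx orbT.
Qed.

(* Layer-cake identity, by approximating [min (X k) z] uniformly with a step
   function of its exceedance events and [G z] by the matching Riemann sum. *)
Lemma exp_trunc (Y : T -> R) k z : bounded_mfun d T R Y -> 0 <= z ->
  (forall t, EE (fun w => Y w * \1_(exceed k t) w) = EE Y * F t) ->
  EE (fun w => Y w * Num.min (X k w) z) = EE Y * G z.
Proof.
move=> bY z0 hY; have [mY [M HM]] := bY.
apply/eqP; rewrite -subr_eq0 -normr_eq0; apply/eqP.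
set a := `| _ |; have a0 : 0 <= a by exact: normr_ge0.
(* A fixed nonnegative number below a constant over [N.+1] for every [N] is zero. *)
suff H : forall N : nat, a <= (M + `|EE Y|) * (z / N.+1%:R).
  apply/eqP; rewrite eq_le a0 andbT leNgt; apply/negP => agt0.
  pose b := (M + `|EE Y|) * z.
  have := H (Num.truncn (b / a)); rewrite mulrA ler_pdivlMr ?ltr0Sn// -/b.
  have := truncnS_gt (b / a); rewrite ltr_pdivrMr// mulrC.
  by move=> h1 h2; have := lt_le_trans h1 h2; rewrite ltxx.
move=> N; pose h := z / N.+1%:R.
have N0 : N.+1%:R != 0 :> R by rewrite pnatr_eq0.
have zh : z = N.+1%:R * h by rewrite /h mulrC divfK.
have h0 : 0 <= h by rewrite divr_ge0.
rewrite -/h.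
pose D w := \sum_(m < N.+1) h * \1_(exceed k (m.+1%:R * h)) w : R.
have bD : bounded_mfun d T R D.
  by apply: bmf_sum => m _; exact/bmfZ/bmf_exceed.
have bZ := bmf_trunc k z z0.
have ED : EE (fun w => Y w * D w) =
    EE Y * \sum_(m < N.+1) h * F (m.+1%:R * h).
  rewrite mulr_sumr.
  transitivity (EE (fun w => \sum_(m < N.+1)
      h * (Y w * \1_(exceed k (m.+1%:R * h)) w))).
    apply: eq_Rintegral => w _; rewrite mulr_sumr; apply: eq_bigr => m _.
    by rewrite mulrCA.
  rewrite exp_sum => [|m _]; last exact/bmfZ/bmfM/bmf_exceed.
  apply: eq_bigr => m _; rewrite expZ; last exact/bmfM/bmf_exceed.
  by rewrite hY mulrCA.
have rD w : `|Num.min (X k w) z - D w| <= h.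
  have := riemann_sum _ _ _ h N.+1 (min_primitive _ _ (X_ge0 k w)) _ h0.
  rewrite -zh /D => H; rewrite (eq_bigr _ (fun m _ => congr1 ( *%R h) (indicE _ _ _))).
  have -> : \sum_(m < N.+1) h * (w \in exceed k (m.+1%:R * h))%:R =
    \sum_(m < N.+1) h * ((m.+1%:R * h <= X k w)%R)%:R.
    apply: eq_bigr => m _; congr (_ * (nat_of_bool _)%:R).
    by apply/idP/idP; rewrite inE.
  by apply: H => x; case: (x <= _) => /=; rewrite ?ler01 lexx.
have rG := riemann_sum _ _ _ h N.+1 Gint_primitive tailF01 h0.
rewrite -zh in rG.
(* By [ED] the two step-function terms cancel. What remains is one discretization error for the
   variable, at most [M * h], and one for [G z], at most [h] times the modulus of [EE Y]. *)
have -> : a = `|EE (fun w => Y w * (Num.min (X k w) z - D w)) -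
    EE Y * (G z - \sum_(m < N.+1) h * F (m.+1%:R * h))|.
  rewrite /a; congr `| _ |; rewrite mulrBr -ED.
  rewrite -[X in _ = X - _]/(EE _).
  have -> : EE (fun w => Y w * (Num.min (X k w) z - D w)) =
    EE (fun w => Y w * Num.min (X k w) z) - EE (fun w => Y w * D w).
    rewrite -expB; [|exact: bmfM|exact: bmfM].
    by apply: eq_Rintegral => w _; rewrite mulrBr.
  ring.
rewrite (le_trans (ler_normB _ _))// mulrDl lerD//; last first.
  by rewrite normrM ler_wpM2l.
have bB := bmfB _ _ bZ bD.
rewrite ler_norml; apply/andP; split.
  rewrite -[leLHS](exp_cst P); apply: exp_le; [exact: bmf_cst|exact: bmfM|].
  by move=> w /=; rewrite lerNl (le_trans (ler_norm _))// normrN normrM ler_pM.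
rewrite -[leRHS](exp_cst P); apply: exp_le; [exact: bmfM|exact: bmf_cst|].
move=> w; rewrite (le_trans (ler_norm _))// normrM.
by rewrite ler_pM.
Qed.

(** * Centered truncated sums and Chebyshev's inequality *)

Lemma measurable_ge (f : T -> R) r : measurable_fun setT f ->
  measurable [set w | r <= f w].
Proof.
move=> mf; rewrite (_ : [set w | _] = f @^-1` `[r, +oo[%classic); last first.
  by apply/seteqP; split => w /=; rewrite in_itv/= andbT.
rewrite -[X in measurable X]setTI; exact: mf.
Qed.

Lemma bmf_centered j z : 0 <= z ->
  bounded_mfun d T R (fun w => Num.min (X j w) z - G z).
Proof. by move=> z0; apply: bmfB; [exact: bmf_trunc|exact: bmf_cst]. Qed.

Lemma bmf_centered_sum (Q : pred nat) n z : 0 <= z ->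
  bounded_mfun d T R (fun w => \sum_(j < n | Q j) (Num.min (X j w) z - G z)).
Proof. by move=> z0; apply: bmf_sum => j _; exact: bmf_centered. Qed.

Definition deviation (Q : pred nat) (n : nat) (z r : R) : set T :=
  [set w | r <= `|\sum_(j < n | Q j) (Num.min (X j w) z - G z)|].

Lemma measurable_deviation Q n z r : 0 <= z -> measurable (deviation Q n z r).
Proof.
move=> z0; apply: measurable_ge; apply: measurableT_comp => //.
by case: (bmf_centered_sum Q n z z0).
Qed.

Lemma indicM_setI (A B : set T) w : \1_A w * \1_B w = \1_(A `&` B) w :> R.
Proof. by rewrite indicI. Qed.

Lemma exp_indep_trunc A Q j z : indep_of A Q -> Q j -> 0 <= z ->
  EE (fun w => \1_A w * Num.min (X j w) z) = pr A * G z.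
Proof.
move=> [mA h1 _] Qj z0; rewrite -[in RHS]exp_indic//.
apply: exp_trunc => //; first exact: bmf_indic.
move=> t; rewrite (_ : (fun w => _) = \1_(A `&` exceed j t)); last first.
  by apply/funext => w; rewrite indicM_setI.
rewrite !exp_indic// ?h1//; apply: measurableI => //; exact: measurable_exceed.
Qed.

Lemma exp_centered A Q j z : indep_of A Q -> Q j -> 0 <= z ->
  EE (fun w => \1_A w * (Num.min (X j w) z - G z)) = 0.
Proof.
move=> iA Qj z0; have [mA _ _] := iA.
transitivity (EE (fun w => \1_A w * Num.min (X j w) z - G z * \1_A w)).
  by apply: eq_Rintegral => w _; rewrite mulrBr [_ * G z]mulrC.
have bA := @bmf_indic _ _ R _ mA.
rewrite expB; [|exact/bmfM/bmf_trunc|exact: bmfZ].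
rewrite expZ// exp_indic// (exp_indep_trunc _ _ _ _ iA)//; ring.
Qed.

(** The layer-cake identity is applied to the factor [k] against the signed weight [Y], which has
    mean zero. Its hypothesis at level [t] is that [j] stays centered on the smaller event where
    also [X k] reaches [t]. *)
Lemma exp_centered_cross A Q j k z : indep_of A Q -> Q j -> Q k -> j != k ->
  0 <= z ->
  EE (fun w => \1_A w * (Num.min (X j w) z - G z) * (Num.min (X k w) z - G z)) = 0.
Proof.
move=> iA Qj Qk jk z0; have [mA h1 h2] := iA.
have bA := @bmf_indic _ _ R _ mA.
have bW := bmf_centered _ _ z0.
pose Y w := \1_A w * (Num.min (X j w) z - G z).
have bY : bounded_mfun d T R Y by exact: bmfM.
have EY : EE Y = 0 by exact: exp_centered iA Qj z0.
transitivity (EE (fun w => Y w * Num.min (X k w) z - G z * Y w)).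
  by apply: eq_Rintegral => w _; rewrite -/(Y w); ring.
rewrite expB; [|exact/bmfM/bmf_trunc|exact: bmfZ].
rewrite expZ// EY mulr0 subr0 exp_trunc ?EY ?mul0r// => t.
have mAk : measurable (A `&` exceed k t).
  by apply: measurableI => //; exact: measurable_exceed.
(* With a single admissible index the clause on pairs is vacuous, so no further joint independence
   is called for. *)
have iAk : indep_of (A `&` exceed k t) (pred1 j).
  split => // [i s /eqP ->|i l s u /eqP -> /eqP ->]; last by rewrite eqxx.
  by rewrite setIAC h2// h1//; ring.
rewrite mul0r -[RHS](exp_centered _ _ _ _ iAk (eqxx j) z0).
by apply: eq_Rintegral => w _; rewrite -indicM_setI /Y; ring.
Qed.

(** Keeping the event [A] inside the expectation yields a bound with the factor [pr A]. This
    controls the remaining summands jointly with a jump of one of them. *)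
Lemma chebyshev A Q n z r v : indep_of A Q -> 0 <= z -> 0 <= r -> 0 <= v ->
  (forall j, Q j -> EE (fun w => \1_A w * Num.min (X j w) z ^+ 2) <= pr A * v) ->
  pr (A `&` deviation Q n z r) * r ^+ 2 <= pr A * (n%:R * v).
Proof.
move=> iA z0 r0 v0 hv; have [mA h1 h2] := iA.
have bA := @bmf_indic _ _ R _ mA.
pose W j w := Num.min (X j w) z - G z.
have bW j : bounded_mfun d T R (W j) by exact: bmf_centered.
pose S w := \sum_(j < n | Q j) W j w.
have bS : bounded_mfun d T R S by exact: bmf_centered_sum.
have mAB : measurable (A `&` deviation Q n z r).
  by apply: measurableI => //; exact: measurable_deviation.
have bAWW j k : bounded_mfun d T R (fun w => \1_A w * W j w * W k w).
  by apply: bmfM => //; apply: bmfM.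
apply: (@le_trans _ _ (EE (fun w => \1_A w * (S w * S w)))).
  rewrite mulrC -exp_indic// -expZ; last exact: bmf_indic.
  apply: exp_le; [exact/bmfZ/bmf_indic|exact: bmfM _ _ bA (bmfM _ _ bS bS)|].
  move=> w; rewrite -indicM_setI mulrCA; apply: ler_wpM2l; first by rewrite indicE.
  rewrite indicE; case: (boolP (w \in _)) => [|_]; last first.
    by rewrite mulr0 -expr2 sqr_ge0.
  rewrite inE /deviation/= -/(S w) mulr1 => rS.
  by rewrite -expr2 -[leRHS]real_normK ?num_real// ler_sqr ?nnegrE.
have -> : EE (fun w => \1_A w * (S w * S w)) =
    \sum_(j < n | Q j) \sum_(k < n | Q k) EE (fun w => \1_A w * W j w * W k w).
  under eq_bigr do rewrite -exp_sum//.
  rewrite -exp_sum => [|j _]; last exact: bmf_sum.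
  apply: eq_Rintegral => w _.
  rewrite [in LHS]/S mulr_suml mulr_sumr; apply: eq_bigr => j _.
  by rewrite mulr_sumr mulr_sumr; apply: eq_bigr => k _; rewrite mulrA.
apply: (@le_trans _ _ (\sum_(j < n | Q j) (pr A * v))).
  apply: ler_sum => j Qj.
  rewrite (bigD1 j)//= big1 ?addr0; last first.
    move=> k /andP[Qk kj]; apply: exp_centered_cross iA Qj Qk _ z0.
    by rewrite eq_sym.
  have bZ := bmf_trunc j z z0.
  have bZ2 : bounded_mfun d T R (fun w => \1_A w * Num.min (X j w) z ^+ 2).
    by apply: bmfM => //; under eq_fun do rewrite expr2; exact: bmfM.
  apply: le_trans (hv _ Qj).
  (* Centering subtracts [G z ^+ 2 * pr A], so the raw second moment is an upper bound. *)
  have -> : EE (fun w => \1_A w * W j w * W j w) =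
      EE (fun w => \1_A w * Num.min (X j w) z ^+ 2) - G z ^+ 2 * pr A.
    transitivity (EE (fun w => \1_A w * Num.min (X j w) z ^+ 2 -
       (2 * G z * (\1_A w * Num.min (X j w) z) - G z ^+ 2 * \1_A w))).
      by apply: eq_Rintegral => w _; rewrite /W; ring.
    rewrite expB//; last by apply: bmfB; apply: bmfZ => //; exact: bmfM.
    rewrite expB; try by apply: bmfZ => //; exact: bmfM.
    rewrite !expZ// ?exp_indic//; last exact: bmfM.
    rewrite (exp_indep_trunc _ _ _ _ iA)//; ring.
  by rewrite gerBl; apply: mulr_ge0; [exact: sqr_ge0|exact: pr_ge0].
have -> : pr A * (n%:R * v) = \sum_(j < n) (pr A * v).
  by rewrite sumr_const card_ord -mulr_natl; ring.
rewrite big_mkcond; apply: ler_sum => j _; case: ifP => // _.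
by rewrite mulr_ge0 ?pr_ge0.
Qed.

(** * Second moments and bounds on the tail of the sum *)

Hypothesis rF : regular_tail R F.

Lemma second_moment_crude A Q j z : indep_of A Q -> Q j -> 0 <= z ->
  EE (fun w => \1_A w * Num.min (X j w) z ^+ 2) <= pr A * (z * G z).
Proof.
move=> iA Qj z0; have [mA _ _] := iA.
have bA := @bmf_indic _ _ R _ mA.
have bZ := bmf_trunc j z z0.
have bZ2 := bmfM _ _ bZ bZ.
apply: (@le_trans _ _ (EE (fun w => z * (\1_A w * Num.min (X j w) z)))).
  apply: exp_le; [exact: bmfM|exact/bmfZ/bmfM|].
  move=> w; rewrite [leRHS]mulrCA; apply: ler_wpM2l; first by rewrite indicE.
  by rewrite expr2 ler_wpM2r ?le_min ?X_ge0// ge_min lexx orbT.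
rewrite expZ; last exact: bmfM.
by rewrite (exp_indep_trunc _ _ _ _ iA)// mulrCA.
Qed.

(** Doubling the truncation level from [s] changes the square only where the variable reaches [s],
    and there by at most [4 * s ^+ 2]. This is the recursive hypothesis of
    [truncated_moment_bound]. *)
Lemma second_moment_tail :
  exists C z0 : R, [/\ 0 < C, 0 < z0 &
    forall A Q j z, indep_of A Q -> Q j -> z0 <= z ->
    EE (fun w => \1_A w * Num.min (X j w) z ^+ 2) <= pr A * (C * z ^+ 2 * F z)].
Proof.
have [C [z0 [C0 z00 H]]] := truncated_moment_bound rF.
exists C, z0; split => // A Q j z iA Qj zz0; have [mA h1 _] := iA.
have bA := @bmf_indic _ _ R _ mA.
have bZ2 s : 0 <= s -> bounded_mfun d T R (fun w => Num.min (X j w) s ^+ 2).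
  by move=> s0; exact: bmfM _ _ (bmf_trunc j s s0) (bmf_trunc j s s0).
apply: (H (fun z => EE (fun w => \1_A w * Num.min (X j w) z ^+ 2))) => //.
- exact: pr_ge0.
- move=> s s0; apply: exp_indicM => //; first exact: bZ2.
  move=> w; rewrite ler_sqr ?nnegrE ?le_min ?X_ge0//.
  by rewrite ge_min lexx orbT.
- move=> s s0; have mAj : measurable (A `&` exceed j s).
    by apply: measurableI => //; exact: measurable_exceed.
  have -> : EE (fun w => \1_A w * Num.min (X j w) s ^+ 2) +
        pr A * (4 * s ^+ 2 * F s) =
      EE (fun w => \1_A w * Num.min (X j w) s ^+ 2 +
        4 * s ^+ 2 * \1_(A `&` exceed j s) w).
    rewrite expD; [|exact/bmfM/bZ2|exact/bmfZ/bmf_indic].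
    by rewrite expZ ?exp_indic// ?h1//; [ring|exact: bmf_indic].
  apply: exp_le; [apply: bmfM => //; apply: bZ2; lra|
    apply: bmfD; [exact/bmfM/bZ2|exact/bmfZ/bmf_indic]|].
  move=> w; rewrite -indicM_setI [X in _ + X]mulrCA -mulrDr; apply: ler_wpM2l.
    by rewrite indicE.
  rewrite [\1_(exceed j s) w]indicE; have x0 := X_ge0 j w.
  case: (boolP (w \in exceed j s)) => [_|/negP h] /=.
    rewrite mulr1 (_ : 4 * s ^+ 2 = (2 * s) ^+ 2); last ring.
    apply: (@le_trans _ _ ((2 * s) ^+ 2)); last by rewrite lerDr sqr_ge0.
    rewrite ler_sqr ?nnegrE; last lra; first by rewrite ge_min lexx orbT.
    by rewrite le_min x0; lra.
  have {}h : X j w < s.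
    by rewrite ltNge; apply/negP => h'; apply: h; exact: mem_set.
  rewrite mulr0 addr0.
  by rewrite !min_l//; lra.
Qed.

Lemma measurable_tail_event n x : measurable [set w | x <= partial_sum X n w].
Proof. by apply/measurable_ge/measurable_sum => i; exact: X_measurable. Qed.

(** A sum below [x] dominates its truncation at [x], which then falls short of its mean [n * G x] by
    at least [n * G x - x]. *)
Lemma tailFn_ge_crude n x : 0 <= x -> x <= n%:R * G x ->
  (1 - tailFn P X n x) * (n%:R * G x - x) ^+ 2 <= n%:R * (x * G x).
Proof.
move=> x0 xn; have Gx0 := prim_ge0 rF Gint_primitive x x0.
have mS := measurable_tail_event n x.
have P1 : pr setT = 1 by have := @probability_setT _ _ _ P => /= ->.
have xG0 : 0 <= x * G x by exact: mulr_ge0.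
have r0 : 0 <= n%:R * G x - x by rewrite subr_ge0.
have := chebyshev _ _ n _ _ _ indep_of_setT x0 r0 xG0
  (fun j Qj => second_moment_crude _ _ j x indep_of_setT Qj x0).
rewrite [X in _ <= X * _]P1 mul1r; apply: le_trans.
rewrite ler_wpM2r ?sqr_ge0// lerBlDl -[leLHS]P1.
have mD : measurable (setT `&` deviation predT n x (n%:R * G x - x)).
  by apply: measurableI => //; exact: measurable_deviation.
apply: pr_leU => // w _; have [xS|Sx] := leP x (partial_sum X n w).
  by left.
right; split => //; rewrite /deviation /=.
apply: (@le_trans _ _ (- \sum_(j < n) (Num.min (X j w) x - G x))).
  rewrite sumrB sumr_const card_ord -mulr_natl.
  suff : \sum_(j < n) Num.min (X j w) x <= x by lra.
  apply: le_trans (ltW Sx); apply: ler_sum => j _.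
  by rewrite ge_min lexx.
by rewrite -normrN ler_norm.
Qed.

Lemma deviation_bound : exists C z0 : R, [/\ 0 < C, 0 < z0 &
  forall A Q n z r, indep_of A Q -> z0 <= z -> 0 < r ->
  pr (A `&` deviation Q n z r) <= pr A * (C * z ^+ 2 * (n%:R * F z) / r ^+ 2)].
Proof.
have [C [z0 [C0 z00 H]]] := second_moment_tail; exists C, z0; split => //.
move=> A Q n z r iA zz0 r0; have z0' : 0 <= z by lra.
have v0 : 0 <= C * z ^+ 2 * F z.
  by rewrite mulr_ge0 ?(ltW (tail_gt0 rF z))// mulr_ge0 ?sqr_ge0// ltW.
have := chebyshev _ _ n _ _ _ iA z0' (ltW r0) v0 (fun j Qj => H _ _ _ _ iA Qj zz0).
rewrite -ler_pdivlMr ?exprn_gt0// => /le_trans; apply.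
by rewrite le_eqVlt; apply/orP; left; apply/eqP; ring.
Qed.

Lemma partial_sum_ge (Q : pred nat) n z r w : ~ deviation Q n z r w ->
  \sum_(j < n | Q j) G z - r < \sum_(j < n | Q j) X j w.
Proof.
rewrite /deviation /= => /negP; rewrite -ltNge ltr_norml => /andP[h _].
rewrite sumrB in h.
suff : \sum_(j < n | Q j) Num.min (X j w) z <= \sum_(j < n | Q j) X j w by lra.
by apply: ler_sum => j _; rewrite ge_min lexx.
Qed.

Lemma sum_cstD1 (i n : nat) (c : R) : (i < n)%N ->
  \sum_(j < n | (j : nat) != i) c = n%:R * c - c.
Proof.
move=> lin; have : \sum_(j < n) c = n%:R * c by rewrite sumr_const card_ord mulr_natl.
rewrite (bigD1 (Ordinal lin))//= => <-; rewrite addrC addrK.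
by apply: eq_bigl => j; rewrite -val_eqE.
Qed.

Lemma sumD1 (i n : nat) w : (i < n)%N ->
  partial_sum X n w = X i w + \sum_(j < n | (j : nat) != i) X j w.
Proof.
by move=> lin; rewrite /partial_sum (bigD1 (Ordinal lin)).
Qed.

(** For the lower bound, one jump exceeds [(a + e) * y] while the other summands deviate little;
    Bonferroni handles several jumps. For the upper bound, there are three cases: a jump of at least
    [(a - e) * y]; a jump of at least [k * y] with the other summands still too large; or no jump of
    size [k * y], and then a deviation of the truncated sum. *)
Lemma tailFn_bounds : exists C z0 : R, [/\ 0 < C, 0 < z0 &
  forall (n : nat) y a e k, z0 <= y -> z0 <= k * y -> 0 < k -> k <= 1 ->
    0 < e -> e < a -> G y <= e / 2 * y ->
  n%:R * F ((a + e) * y) *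
      (1 - 4 * C / e ^+ 2 * (n%:R * F y) - n%:R * F ((a + e) * y))
    <= tailFn P X n (n%:R * G y + a * y) /\
  tailFn P X n (n%:R * G y + a * y) <=
    n%:R * F ((a - e) * y) +
    n%:R * F (k * y) * (1 + C / e ^+ 2) * (n%:R * F y) +
    C * k ^+ 2 / a ^+ 2 * (n%:R * F (k * y))].
Proof.
have [C [z0 [C0 z00 H]]] := deviation_bound; exists C, z0; split => //.
move=> n y a e k yz0 kyz0 k0 k1 e0 ea Gy.
have y0 : 0 < y by lra.
have mS := measurable_tail_event n (n%:R * G y + a * y).
have n0 : 0 <= n%:R :> R by [].
have mdev Q r : measurable (deviation Q n y r) by apply: measurable_deviation; lra.
have mex := measurable_exceed.
split.
(* Half of the margin [e * y] absorbs the deviation, the other half the mean [G y] of the summand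
   left out. *)
- set u := (a + e) * y; pose D i := deviation (fun j => j != i) n y (e / 2 * y).
  pose E (i : 'I_n) := exceed i u `\` D i.
  have mD i : measurable (D i) by exact: mdev.
  have mE i : measurable (E i) by exact: measurableD.
  have EA i : E i `<=` [set w | n%:R * G y + a * y <= partial_sum X n w].
    move=> w [Xu /partial_sum_ge].
    rewrite sum_cstD1//= (sumD1 i)//; move: Xu; rewrite /exceed /u /= mulrDl; lra.
  apply: le_trans (pr_ge_bonferroni P _ _ _ mS mE EA).
  have pE (i : 'I_n) : F u * (1 - 4 * C / e ^+ 2 * (n%:R * F y)) <= pr (E i).
    have e2y : 0 < e / 2 * y by rewrite mulr_gt0// divr_gt0.
    have := H _ _ n _ _ (indep_of_exceed i u) yz0 e2y; rewrite pr_exceed -/(D i).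
    have -> : C * y ^+ 2 * (n%:R * F y) / (e / 2 * y) ^+ 2 =
      4 * C / e ^+ 2 * (n%:R * F y).
      by field; rewrite !gt_eqF.
    have := pr_leU P (exceed i u) (E i) (exceed i u `&` D i) (mex _ _) (mE i) _ _.
    rewrite pr_exceed => h1 h2; rewrite mulrBr mulr1 lerBlDr.
    apply: le_trans (h1 _ _) _; first exact: measurableI.
      by move=> w hw; have [|] := pselect (D i w); [right|left].
    by rewrite lerD2l.
  have pEE (i j : 'I_n) : j != i -> pr (E i `&` E j) <= F u * F u.
    move=> ji; rewrite -(exceed_indep2 i j u u); last by rewrite eq_sym val_eqE.
    by apply: pr_le; [exact: measurableI|exact: measurableI|move=> w [[? _] [? _]]].
  have s1 : n%:R * (F u * (1 - 4 * C / e ^+ 2 * (n%:R * F y))) <= \sum_(i < n) pr (E i).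
    rewrite mulr_natl -[n in _ *+ n]card_ord -sumr_const; exact: ler_sum.
  have s2 : \sum_(i < n) \sum_(j < n | j != i) pr (E i `&` E j) <=
      n%:R * (n%:R * (F u * F u)).
    rewrite mulr_natl -[n in _ *+ n]card_ord -sumr_const; apply: ler_sum => i _.
    rewrite mulr_natl -[n in _ *+ n]card_ord -sumr_const big_mkcond.
    apply: ler_sum => j _; case: ifP => [/pEE//|_].
    by rewrite -expr2 sqr_ge0.
  by move: s1 s2; move: (\sum_(i < n) _) (\sum_(i < n) _) => S1 S2; lra.
- have ey : 0 < e * y by exact: mulr_gt0.
  have ay : 0 < a * y by rewrite mulr_gt0//; lra.
  pose Rest i := [set w | n%:R * G y + e * y <= \sum_(j < n | (j : nat) != i) X j w].
  have mRest i : measurable (Rest i).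
    pose h (j : 'I_n) := if (j : nat) != i then X j else cst 0.
    apply: measurable_ge; rewrite (_ : (fun _ => _) = fun w => \sum_(j < n) h j w).
      apply: measurable_sum => j; rewrite /h; case: ifP => _; first exact: X_measurable.
      exact: measurable_cst.
    apply/funext => w; rewrite big_mkcond; apply: eq_bigr => j _.
    by rewrite /h; case: ifP.
  pose B1 (i : 'I_n) := exceed i ((a - e) * y).
  pose B2 (i : 'I_n) := exceed i (k * y) `&` Rest i.
  pose D i := deviation (fun j => j != i) n y (e * y).
  have mD i : measurable (D i) by exact: mdev.
  (* The factor [n * F y] beyond the jump of [i] arises because the other summands either contain a
     second jump of size [y] or deviate after truncation at [y]. *)
  have pB2 i : pr (B2 i) <= F (k * y) * (1 + C / e ^+ 2) * (n%:R * F y).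
    have mB2 : measurable (B2 i) by exact: measurableI.
    pose U := B2 i `\` D i; have mU : measurable U by exact: measurableD.
    have mkD : measurable (exceed i (k * y) `&` D i) by exact: measurableI.
    pose V (j : 'I_n) := if j == i then set0 else exceed i (k * y) `&` exceed j y.
    have mV j : measurable (V j) by rewrite /V; case: ifP => // _; exact: measurableI.
    have h1 : pr (B2 i) <= pr U + pr (exceed i (k * y) `&` D i).
      apply: pr_leU => // w hw; have [h|h] := pselect (D i w); last by left.
      by right; split => //; case: hw.
    have h2 : pr U <= \sum_(j < n) pr (V j).
      apply: pr_le_bigcup => // w [[hi hR] hD].
      apply: contrapT => hno; apply: hD.
      have small (j : 'I_n) : j != i -> X j w < y.
        move=> ji; rewrite ltNge; apply/negP => h; apply: hno; exists j.
        by rewrite /V (negbTE ji).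
      rewrite /D /deviation /=; apply: le_trans (ler_norm _).
      rewrite sumrB sum_cstD1//.
      have -> : \sum_(j < n | (j : nat) != i) Num.min (X j w) y =
        \sum_(j < n | (j : nat) != i) X j w.
        by apply: eq_bigr => j ji; rewrite min_l// ltW// small.
      have := prim_ge0 rF Gint_primitive y (ltW y0).
      move: hR; rewrite /Rest /=; lra.
    have h3 : \sum_(j < n) pr (V j) <= n%:R * (F (k * y) * F y).
      rewrite mulr_natl -[n in _ *+ n]card_ord -sumr_const; apply: ler_sum => j _.
      rewrite /V; case: ifP => [_|/negbT ji].
        by rewrite measure0 mulr_ge0// ltW// tail_gt0.
      by rewrite exceed_indep2// eq_sym val_eqE.
    have := H _ _ n _ _ (indep_of_exceed i (k * y)) yz0 ey; rewrite pr_exceed -/(D i).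
    have -> : C * y ^+ 2 * (n%:R * F y) / (e * y) ^+ 2 = C / e ^+ 2 * (n%:R * F y).
      by field; rewrite !gt_eqF.
    move=> h4; apply: (le_trans h1); apply: (le_trans (lerD (le_trans h2 h3) h4)).
    by rewrite le_eqVlt; apply/orP; left; apply/eqP; ring.
  have mB1 i : measurable (B1 i) by exact: mex.
  have mB2 i : measurable (B2 i) by exact: measurableI.
  pose D4 := setT `&` deviation predT n (k * y) (a * y).
  have mD4 : measurable D4 by apply: measurableI => //; apply: measurable_deviation; lra.
  pose A := [set w | n%:R * G y + a * y <= partial_sum X n w].
  have h1 : pr A <= pr (A `\` D4) + pr D4.
    apply: pr_leU => //; first exact: measurableD.
    by move=> w hw; have [h|h] := pselect (D4 w); [right|left].
  have h2 : pr (A `\` D4) <= \sum_(i < n) pr (B1 i `|` B2 i).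
    apply: pr_le_bigcup => [|i|w [hA hD]]; [exact: measurableD|exact: measurableU|].
    apply: contrapT => hno; apply: hD; split => //.
    have hno1 (i : 'I_n) : X i w < (a - e) * y.
      by rewrite ltNge; apply/negP => h; apply: hno; exists i; left.
    (* A jump in [[k * y, (a - e) * y[] would leave at least [n * G y + e * y] to the others, which
       is the event [B2]. *)
    have hno2 (i : 'I_n) : X i w < k * y.
      rewrite ltNge; apply/negP => h; apply: hno; exists i; right; split => //.
      have := hno1 i; move: hA; rewrite /A /Rest /= (sumD1 i)// mulrBl; lra.
    rewrite /deviation /=; apply: le_trans (ler_norm _).
    rewrite sumrB sumr_const card_ord -mulr_natl.
    (* The sum now equals its truncation at [k * y], whose mean [n * G (k * y)] is at most
       [n * G y]. *)
    have -> : \sum_(j < n) Num.min (X j w) (k * y) = partial_sum X n w.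
      by apply: eq_bigr => j _; rewrite min_l// ltW.
    have : n%:R * G (k * y) <= n%:R * G y.
      rewrite ler_wpM2l//; apply: (prim_nd rF Gint_primitive); first lra.
      by rewrite ler_piMl// ltW.
    move: hA; rewrite /A /=; lra.
  have h3 : \sum_(i < n) pr (B1 i `|` B2 i) <= n%:R * (F ((a - e) * y) +
      F (k * y) * (1 + C / e ^+ 2) * (n%:R * F y)).
    rewrite mulr_natl -[n in _ *+ n]card_ord -sumr_const; apply: ler_sum => i _.
    apply: (@le_trans _ _ (pr (B1 i) + pr (B2 i))).
      by apply: pr_leU => //; exact: measurableU.
    by rewrite lerD// /B1 pr_exceed.
  have h4 : pr D4 <= C * k ^+ 2 / a ^+ 2 * (n%:R * F (k * y)).
    have := H _ _ n _ _ indep_of_setT kyz0 ay.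
    have P1 : pr setT = 1 by have := @probability_setT _ _ _ P => /= ->.
    rewrite [X in _ <= X * _]P1 mul1r => /le_trans; apply.
    rewrite le_eqVlt; apply/orP; left; apply/eqP; field.
    by rewrite !gt_eqF//; lra.
  apply: (le_trans h1); apply: (le_trans (lerD (le_trans h2 h3) h4)).
  by rewrite le_eqVlt; apply/orP; left; apply/eqP; ring.
Qed.

End IidSequence.

(** * Large deviations *)

Section UniformLargeDeviations.
Context {d : measure_display} {T : measurableType d} {R : realType}.
Variables (P : probability T R) (X : nat -> T -> R).
Hypothesis iidX : iid_nonneg P X.
Local Notation F := (tailF P X).
Local Notation G := (Gint P X).
Hypothesis rF : regular_tail R F.

(** The constants are fixed in the order [eta], [e], [k], [th]. The error term linear in
    [n * F (k * y)] is made small by [k], every other one by [n * F y <= th]. *)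
Lemma uniform_large_deviations (c A A' eps : R) :
  0 < c -> 0 < A -> A <= A' -> 0 < eps ->
  exists N : nat, forall (n : nat) y a, (N <= n)%N -> 0 < y ->
    c * n%:R * G y <= y -> A <= a -> a <= A' ->
    `|tailFn P X n (n%:R * G y + a * y) / (n%:R * F (a * y)) - 1| <= eps.
Proof.
move=> c0 A0 AA' eps0; have pG := Gint_primitive P X iidX.
have A'0 : 0 < A' by lra.
have [C [z0 [C0 z00 H]]] := tailFn_bounds P X iidX rF.
(* The relative error is at most [2 * eta] from shifting the jump plus twice [eta] from the two
   remaining terms above, and [1 - (1 - eta) ^+ 2] below. *)
pose eta := Num.min (1 / 4) (eps / 4).
have eta0 : 0 < eta by rewrite lt_min; apply/andP; split; lra.
have eta4 : eta <= 1 / 4 by rewrite /eta ge_min lexx.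
have etae : 4 * eta <= eps.
  by have : eta <= eps / 4 by [rewrite /eta ge_min lexx orbT]; lra.
pose e := eta * A; have e0 : 0 < e by exact: mulr_gt0.
(* The last upper error is at most [C * k ^+ 2 / a ^+ 2 * (2 * A' / k)] times the main term, hence
   of order [k]; this choice makes it at most [eta]. *)
pose k := Num.min 1 (eta * A ^+ 2 / (2 * C * A')).
have CA' : 0 < 2 * C * A' by rewrite !mulr_gt0.
have k0 : 0 < k by rewrite lt_min ltr01 divr_gt0// mulr_gt0// exprn_gt0.
have k1 : k <= 1 by rewrite /k ge_min lexx.
have kC : 2 * C * A' * k <= eta * A ^+ 2.
  by rewrite mulrC -ler_pdivlMr// /k ge_min lexx orbT.
(* [t1] multiplies [n * F y] in the error from two-stage jumps, [t2] in the two losses of the lower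
   bound; [th] keeps both contributions below [eta]. *)
pose t1 := 2 * A' / k * (1 + C / e ^+ 2).
pose t2 := 4 * C / e ^+ 2 + 2 / A.
have Ce : 0 < C / e ^+ 2 by rewrite divr_gt0// exprn_gt0.
have Ak : 0 < 2 * A' / k by rewrite divr_gt0// mulr_gt0.
have t10 : 0 < t1 by rewrite /t1 mulr_gt0//; lra.
have t20 : 0 < t2.
  by rewrite /t2 addr_gt0// divr_gt0// ?exprn_gt0// mulr_gt0.
pose th := eta / (t1 + t2); have th0 : 0 < th by rewrite divr_gt0// addr_gt0.
have thE : th * (t1 + t2) = eta by rewrite /th divfK// gt_eqF// addr_gt0.
have tht1 : t1 * th <= eta by have := mulr_gt0 th0 t20; lra.
have tht2 : t2 * th <= eta by have := mulr_gt0 th0 t10; lra.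
have [M1 M10 H1] := tail_scale_ge rF (1 + eta) (1 - eta) ltac:(lra)
  ltac:(rewrite -[ltRHS]div1r ltr_pdivlMr; nra).
have [M2 M20 H2] := tail_scale_le rF (1 - eta) (1 + 2 * eta) ltac:(lra)
  ltac:(rewrite -[ltLHS]div1r ltr_pdivrMr; nra).
(* Thresholds must not depend on [a], so [F (k * y)] is compared with [F (A' * y)], which is at most
   [F (a * y)]. *)
have [M3 M30 H3] := tail_scale_le rF (k / A') (2 * A' / k) ltac:(exact: divr_gt0)
  ltac:(rewrite invf_div -mulrA ltr_pMl ?divr_gt0//; lra).
(* Together with [c * n * G y <= y], this constant yields exactly [n * F y <= th]. *)
have [M4 M40 H4] := prim_dominates_tail rF pG (c * th)^-1.
have [M5 M50 H5] := tail_scale_le rF A (2 / A) A0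
  ltac:(rewrite -[ltLHS]div1r ltr_pM2r ?invr_gt0//; lra).
have [M6 M60 H6] := prim_sublinear rF pG (e / 2) ltac:(lra).
pose M := Num.max z0 (Num.max (z0 / k) (Num.max (M1 / A) (Num.max (M2 / A)
  (Num.max (M3 / A') (Num.max M4 (Num.max M5 M6)))))).
have [N HN] := scale_eventually_large rF pG c M c0.
exists N.+1 => n y a Nn y0 hy Aa aA'.
have {HN} : M <= y by apply: HN hy => //; exact: ltnW.
rewrite /M !ge_max => /and5P[yz0 yk y1 y2 /and4P[y3 y4 y5 y6]].
have kyz0 : z0 <= k * y by rewrite mulrC -ler_pdivrMr.
have Ay : A * y <= a * y by rewrite ler_pM2r.
have aA'y : a * y <= A' * y by rewrite ler_pM2r.
have yM1 : M1 <= a * y by apply: le_trans Ay; rewrite mulrC -ler_pdivrMr.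
have yM2 : M2 <= a * y by apply: le_trans Ay; rewrite mulrC -ler_pdivrMr.
have yM3 : M3 <= A' * y by rewrite mulrC -ler_pdivrMr.
have {}H1 := H1 _ yM1; have {}H2 := H2 _ yM2; have {}H3 := H3 _ yM3.
have {}H4 := H4 _ y4; have {}H5 := H5 _ y5; have {}H6 := H6 _ y6.
clear M y1 y2 y3 y4 y5 y6 yk yM1 yM2 yM3 M10 M20 M30 M40 M50 M60.
have a0 : 0 < a := lt_le_trans A0 Aa.
have ea : e <= eta * a by rewrite /e ler_pM2l.
have ea' : e < a.
  by apply: le_lt_trans ea _; rewrite gtr_pMl//; apply: le_lt_trans eta4 _; lra.
have {H} [] := H n y a e k yz0 kyz0 k0 k1 e0 ea' H6.
have n0 : 0 < n%:R :> R by rewrite ltr0n (leq_trans _ Nn).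
have Fp := tail_gt0 rF.
set q := n%:R * F (a * y); have q0 : 0 < q by rewrite mulr_gt0.
have L1 : (1 - eta) * q <= n%:R * F ((a + e) * y).
  rewrite /q mulrCA ler_pM2l//; apply: le_trans H1 _; apply: (tail_ni rF).
  by rewrite mulrA ler_pM2r//; lra.
have L1' : n%:R * F ((a + e) * y) <= n%:R * F (A * y).
  by rewrite ler_pM2l//; apply: (tail_ni rF); rewrite ler_pM2r//; lra.
have L2 : n%:R * F ((a - e) * y) <= (1 + 2 * eta) * q.
  rewrite /q mulrCA ler_pM2l//; apply: le_trans H2; apply: (tail_ni rF).
  by rewrite mulrA ler_pM2r//; lra.
have L3 : n%:R * F (k * y) <= 2 * A' / k * q.
  rewrite /q mulrCA ler_pM2l//.
  rewrite (_ : k / A' * (A' * y) = k * y) in H3; last by field; rewrite gt_eqF.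
  by apply: le_trans H3 _; rewrite ler_pM2l//; exact: (tail_ni rF).
have L4 : n%:R * F y <= th.
  have cth : 0 < c * th by exact: mulr_gt0.
  have h : c * n%:R * ((c * th)^-1 * (y * F y)) <= y.
    by apply: le_trans hy; rewrite ler_pM2l// mulr_gt0.
  have h' : c * n%:R * ((c * th)^-1 * (y * F y)) = y * (n%:R * F y / th).
    by field; rewrite !gt_eqF.
  by move: h; rewrite h' -[leRHS]mulr1 ler_pM2l// ler_pdivrMr// mul1r.
have L5 : n%:R * F (A * y) <= 2 / A * th.
  apply: (@le_trans _ _ (2 / A * (n%:R * F y))).
    by rewrite mulrCA ler_pM2l.
  by rewrite ler_pM2l// divr_gt0.
clear H1 H2 H3 H4 H5 H6 yz0 kyz0 z00 Ay aA'y ea ea' hy.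
move=> lo up; rewrite ler_norml; apply/andP; split.
- rewrite lerBrDl ler_pdivlMr//; apply: le_trans lo.
  have s1 : 4 * C / e ^+ 2 * (n%:R * F y) <= 4 * C / e ^+ 2 * th.
    by rewrite ler_pM2l// divr_gt0// ?exprn_gt0// mulr_gt0.
  have s2 : 1 - eta <= 1 - 4 * C / e ^+ 2 * (n%:R * F y) - n%:R * F ((a + e) * y).
    by move: tht2; rewrite /t2 mulrDl; lra.
  have s3 : (1 - eta) * q * (1 - eta) <= n%:R * F ((a + e) * y) *
      (1 - 4 * C / e ^+ 2 * (n%:R * F y) - n%:R * F ((a + e) * y)).
    by apply: ler_pM => //; [rewrite mulr_ge0 ?(ltW q0)//|]; lra.
  apply: le_trans s3; have : 0 <= eta ^+ 2 * q by rewrite mulr_ge0 ?sqr_ge0 ?ltW.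
  by have := ler_wpM2r (ltW q0) etae; rewrite expr2; nra.
- rewrite lerBlDl ler_pdivrMr//; apply: (le_trans up).
  have s1 : n%:R * F (k * y) * (1 + C / e ^+ 2) * (n%:R * F y) <= eta * q.
    apply: (@le_trans _ _ (2 * A' / k * q * (1 + C / e ^+ 2) * th)).
      apply: ler_pM => //; [by rewrite !mulr_ge0 ?ltW//; lra|by rewrite mulr_ge0// ltW|].
      by rewrite ler_wpM2r//; lra.
    have -> : 2 * A' / k * q * (1 + C / e ^+ 2) * th = t1 * th * q by rewrite /t1; ring.
    by rewrite ler_pM2r.
  have s2 : C * k ^+ 2 / a ^+ 2 * (n%:R * F (k * y)) <= eta * q.
    apply: (@le_trans _ _ (C * k ^+ 2 / a ^+ 2 * (2 * A' / k * q))).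
      by rewrite ler_wpM2l// divr_ge0 ?sqr_ge0// mulr_ge0 ?sqr_ge0// ltW.
    have -> : C * k ^+ 2 / a ^+ 2 * (2 * A' / k * q) = 2 * C * A' * k / a ^+ 2 * q.
      by field; rewrite !gt_eqF.
    rewrite ler_pM2r// ler_pdivrMr ?exprn_gt0//; apply: (le_trans kC).
    by rewrite ler_pM2l// ler_sqr ?nnegrE// ltW.
  have := ler_wpM2r (ltW q0) etae; lra.
Qed.

End UniformLargeDeviations.

(** * Large deviations along sequences *)

Section SequentialForm.
Context {d : measure_display} {T : measurableType d} {R : realType}.
Variables (P : probability T R) (X : nat -> T -> R).
Hypothesis iidX : iid_nonneg P X.
Local Notation F := (tailF P X).
Local Notation G := (Gint P X).
Hypothesis rF : regular_tail R F.

Let pG := Gint_primitive P X iidX.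

Lemma prim_ratio_mono (K x y : R) : 0 < x -> x <= y -> K * G x <= x -> K * G y <= y.
Proof.
move=> x0 xy hK; have Gx := prim_gt0 rF pG x x0.
have Gy := prim_gt0 rF pG y (lt_le_trans x0 xy).
rewrite -(ler_pM2r Gx) mulrAC; apply: (@le_trans _ _ (x * G y)).
  by rewrite ler_pM2r.
exact: prim_ratio pG _ _ (ltW x0) xy.
Qed.

Lemma ratio_bounds (a b e : R) : 0 < b ->
  (`|a / b - 1| <= e) = ((1 - e) * b <= a <= (1 + e) * b).
Proof.
move=> b0; by rewrite ler_norml lerBrDl [_ - 1 <= _]lerBlDl ler_pdivlMr// ler_pdivrMr.
Qed.

Lemma large_deviations_of_ratio (x : nat -> R) : (forall n, 0 < x n) ->
  (forall K : R, 0 < K -> exists N : nat, forall n, (N <= n)%N ->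
    K * (n%:R * G (x n)) <= x n) ->
  forall eps : R, 0 < eps -> exists N : nat, forall n y, (N <= n)%N -> x n <= y ->
    `|tailFn P X n y / (n%:R * F y) - 1| <= eps.
Proof.
move=> x0 hx eps eps0.
pose eta := Num.min (1 / 4) (eps / 4).
have eta0 : 0 < eta by rewrite lt_min; apply/andP; split; lra.
have eta4 : eta <= 1 / 4 by rewrite /eta ge_min lexx.
have etae : 4 * eta <= eps.
  by have : eta <= eps / 4 by [rewrite /eta ge_min lexx orbT]; lra.
clearbody eta.
have [N1 H1] := hx eta^-1 ltac:(by rewrite invr_gt0).
have [N2 H2] := uniform_large_deviations P X iidX rF 1 (1 / 2) 1 eta
  ltac:(lra) ltac:(lra) ltac:(lra) eta0.
have [M M0 HM] := tail_scale_le rF (1 - eta) (1 + 2 * eta) ltac:(lra)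
  ltac:(rewrite -[ltLHS]div1r ltr_pdivrMr; nra).
have [N3 H3] := scale_eventually_large rF pG 1 M ltac:(lra).
exists (N1 + N2 + N3).+1 => n y Nn xy.
have [N1n [N2n N3n]] : (N1 <= n /\ N2 <= n /\ N3 <= n)%N by clear -Nn; lia.
have y0 := lt_le_trans (x0 n) xy.
have n0 : 0 < n%:R :> R by rewrite ltr0n (leq_trans _ Nn).
have nG : n%:R * G y <= eta * y.
  have := H1 n N1n.
  rewrite mulrA => /(prim_ratio_mono _ _ _ (x0 n) xy).
  by rewrite -mulrA mulrC ler_pdivrMr// [leRHS]mulrC.
have Gy := prim_gt0 rF pG y y0.
have nGy : 1 * n%:R * G y <= y by rewrite mul1r; nra.
(* This solves [n * G y + a * y = y], and lies in [[1 - eta, 1]] because the ratio bound at [x n]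
   passes to all larger [y]. *)
pose a := 1 - n%:R * G y / y.
have r0 : 0 <= n%:R * G y / y by rewrite divr_ge0 ?mulr_ge0 ?ltW.
have r1 : n%:R * G y / y <= eta by rewrite ler_pdivrMr.
have a1 : a <= 1 by rewrite /a; lra.
have a2 : 1 - eta <= a by rewrite /a; lra.
have yM := H3 n y N3n y0 nGy.
have ay : n%:R * G y + a * y = y by rewrite /a mulrBl mul1r divfK ?gt_eqF//; ring.
have := H2 n y a N2n y0 nGy ltac:(lra) a1; rewrite ay.
have Fp := tail_gt0 rF.
rewrite !ratio_bounds; [|by rewrite mulr_gt0|by rewrite mulr_gt0].
have f1 : n%:R * F y <= n%:R * F (a * y).
  by rewrite ler_pM2l//; apply: (tail_ni rF); rewrite ler_piMl// ltW.
have f2 : n%:R * F (a * y) <= (1 + 2 * eta) * (n%:R * F y).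
  rewrite mulrCA ler_pM2l//; apply: le_trans (HM _ yM); apply: (tail_ni rF).
  by rewrite ler_pM2r.
have f0 : 0 < n%:R * F y by rewrite mulr_gt0.
move: (n%:R * F y) (n%:R * F (a * y)) f0 f1 f2 => f g f0 f1 f2 /andP[h1 h2].
clear -eta0 eta4 etae f0 f1 f2 h1 h2.
apply/andP; split.
  apply: le_trans h1; apply: (@le_trans _ _ ((1 - eta) * f)).
    by rewrite ler_pM2r//; lra.
  by rewrite ler_pM2l//; lra.
apply: (le_trans h2); apply: (@le_trans _ _ ((1 + eta) * ((1 + 2 * eta) * f))).
  by rewrite ler_pM2l//; lra.
rewrite mulrA ler_pM2r//; nra.
Qed.

(** At the point [n * G y + y], with [y] comparable to [n * G y], the uniform estimate bounds the
    tail of the sum below by nearly [n * F y], and the hypothesis bounds it above by nearly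
    [k * (n * F y)] with [k < 1]. *)
Lemma ratio_of_large_deviations (x : nat -> R) : (forall n, 0 < x n) ->
  (forall eps : R, 0 < eps -> exists N : nat, forall n y, (N <= n)%N -> x n <= y ->
    `|tailFn P X n y / (n%:R * F y) - 1| <= eps) ->
  forall K : R, 0 < K -> exists N : nat, forall n, (N <= n)%N ->
    K * (n%:R * G (x n)) <= x n.
Proof.
move=> x0 hx K K0.
pose s := (2 * K)^-1; have s0 : 0 < s by rewrite invr_gt0 mulr_gt0.
have sK : s * (2 * K) = 1 by rewrite mulVf// gt_eqF// mulr_gt0.
pose t := (1 + s)^-1; have t0 : 0 < t by rewrite invr_gt0; lra.
have t1 : t < 1 by rewrite invf_lt1; lra.
clearbody s.
(* [k] lies strictly between the limiting ratio [(1 + s)^-1] and 1, and [e] is small enough that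
   [(1 + e) * k < 1 - e]. *)
pose k := (1 + t) / 2; pose e := (1 - k) / 4.
have k1 : k < 1 by rewrite /k; lra.
have kt : (1 + s)^-1 < k by rewrite -/t /k; lra.
have e0 : 0 < e by rewrite /e; lra.
have k0 : 0 < k by rewrite /k; lra.
have [M M0 HM] := tail_scale_le rF (1 + s) k ltac:(lra) kt.
have [N1 H1] := scale_eventually_large rF pG K M K0.
have [N2 H2] := hx e e0.
have [N3 H3] := uniform_large_deviations P X iidX rF K 1 1 e K0 ltr01 (lexx _) e0.
exists (N1 + N2 + N3).+1 => n Nn.
have [N1n [N2n N3n]] : (N1 <= n /\ N2 <= n /\ N3 <= n)%N by clear -Nn; lia.
rewrite leNgt; apply/negP => xn.
have n0 : 0 < n%:R :> R by rewrite ltr0n (leq_trans _ Nn).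
have Kn0 : 0 < K * n%:R by exact: mulr_gt0.
(* Double [x n] until the inequality first holds, which happens because [G] is sublinear. It failed
   one doubling earlier, so [y] overshoots by less than a factor 2, whence [n * G y >= s * y]. *)
have [y [xy y1 y2]] : exists y, [/\ x n <= y, K * n%:R * G y <= y &
    y < 2 * (K * n%:R * G y)].
  pose p (j : nat) := K * n%:R * G (2 ^+ j * x n) <= 2 ^+ j * x n.
  have exp : exists j, p j.
    have [M' M'0 HM'] := prim_sublinear rF pG (K * n%:R)^-1 ltac:(by rewrite invr_gt0).
    exists (Num.truncn (M' / x n)).+1; rewrite /p -ler_pdivlMl//; apply: HM'.
    rewrite -ler_pdivrMr//; apply/ltW/(lt_le_trans (truncnS_gt _)).
    by rewrite -natrX ler_nat ltnW// ltn_expl.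
  case: (ex_minnP exp) => [[|j]] pj jmin.
    by move: pj; rewrite /p expr0 mul1r -mulrA leNgt xn.
  have xj : 0 < 2 ^+ j * x n by rewrite mulr_gt0// exprn_gt0.
  exists (2 ^+ j.+1 * x n); split => //.
    by rewrite ler_peMl// ?exprn_ege1 ?ler1n// ltW.
  have npj : ~~ p j by apply/negP => /jmin; rewrite ltnn.
  move: npj; rewrite /p -ltNge => npj.
  have -> : 2 ^+ j.+1 * x n = 2 * (2 ^+ j * x n) by rewrite exprS mulrA.
  rewrite ltr_pM2l//; apply: (lt_le_trans npj); rewrite ler_pM2l//.
  by apply: (prim_nd rF pG); lra.
have y0 := lt_le_trans (x0 n) xy.
have yM := H1 n y N1n y0 y1.
have Gy := prim_gt0 rF pG y y0.
have Fp := tail_gt0 rF.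
have := H3 n y 1 N3n y0 y1 (lexx _) (lexx _); rewrite mul1r.
have nG0 : 0 <= n%:R * G y by rewrite mulr_ge0 ?ltW.
have := H2 n (n%:R * G y + y) N2n ltac:(lra).
rewrite !ratio_bounds; [|by rewrite mulr_gt0|by rewrite mulr_gt0].
move=> /andP[_ h1] /andP[h2 _].
have h3 : n%:R * F (n%:R * G y + y) <= k * (n%:R * F y).
  rewrite mulrCA ler_pM2l//; apply: le_trans (HM _ yM); apply: (tail_ni rF).
  rewrite mulrDl mul1r addrC lerD2r.
  have <- : s * (2 * (K * n%:R * G y)) = n%:R * G y.
    have -> : s * (2 * (K * n%:R * G y)) = s * (2 * K) * (n%:R * G y) by ring.
    by rewrite sK mul1r.
  by rewrite ler_pM2l// ltW.
have f0 : 0 < n%:R * F y by rewrite mulr_gt0.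
move: (n%:R * F y) f0 h1 h2 h3 => f f0 h1 h2 h3.
have := le_trans h2 h1 => h4.
have : (1 - e) * f <= (1 + e) * (k * f).
  by apply: (le_trans h4); rewrite ler_pM2l//; lra.
have := sqr_ge0 (1 - k); rewrite mulrA ler_pM2r// /e expr2; lra.
Qed.

Lemma tail_cvg1_of_ratio (x : nat -> R) : (forall n, 0 < x n) ->
  (forall e : R, 0 < e -> exists N : nat, forall n, (N <= n)%N ->
    x n <= e * (n%:R * G (x n))) ->
  forall e : R, 0 < e -> exists N : nat, forall n, (N <= n)%N ->
    1 - e <= tailFn P X n (x n).
Proof.
move=> x0 hx e e0; pose eta := Num.min (1 / 2) (e / 4).
have eta0 : 0 < eta by rewrite lt_min; apply/andP; split; lra.
have eta2 : eta <= 1 / 2 by rewrite /eta ge_min lexx.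
have etae : 4 * eta <= e.
  by have : eta <= e / 4 by [rewrite /eta ge_min lexx orbT]; lra.
clearbody eta.
have [N HN] := hx eta eta0; exists N.+1 => n Nn.
have {}HN := HN n (ltnW Nn).
have n0 : 0 < n%:R :> R by rewrite ltr0n (leq_trans _ Nn).
have g0 : 0 < n%:R * G (x n) by rewrite mulr_gt0// (prim_gt0 rF pG).
have xn : x n <= n%:R * G (x n) by nra.
have := tailFn_ge_crude P X iidX rF n (x n) (ltW (x0 n)) xn.
have /andP[_ T1] : 0 <= tailFn P X n (x n) <= 1.
  by rewrite pr_ge0 pr_le1//; exact: (measurable_tail_event P X iidX).
rewrite [leRHS]mulrCA; move: (x0 n) g0 HN xn T1; move: (n%:R * G (x n)) => g.
move: (x n) (tailFn _ _ _ _) => z t z0 g0 h1 h2 t1 h3.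
(* As [z <= g / 2], the Chebyshev bound reads [(1 - t) * g ^+ 2 / 4 <= z * g <= eta * g ^+ 2]. *)
suff : (1 - t) / 4 <= eta by lra.
rewrite -(ler_pM2r g0) -(ler_pM2r g0).
have hg := ler_wpM2r (ltW g0) eta2.
have h4 : (1 - t) * (g / 2) ^+ 2 <= (1 - t) * (g - z) ^+ 2.
  rewrite ler_wpM2l ?subr_ge0// ler_sqr ?nnegrE; lra.
have h5 : z * g <= eta * g * g by rewrite ler_pM2r.
have -> : (1 - t) / 4 * g * g = (1 - t) * (g / 2) ^+ 2 by field.
by apply: (le_trans h4); apply: (le_trans h3).
Qed.

End SequentialForm.

(** * Limits as eventual bounds *)

Lemma near_inftyP (Q : nat -> Prop) :
  (\forall n \near \oo, Q n) <-> exists N : nat, forall n, (N <= n)%N -> Q n.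
Proof.
split=> [[N _ HN]|[N HN]]; first by exists N.
by exists N => // n /= Nn; exact: HN.
Qed.

(** Nonemptiness keeps the suprema nonnegative, the supremum of the empty set being [-oo]. Early
    suprema may be infinite, so finiteness is established only eventually. *)
Lemma cvg_sup0P (R : realType) (f : nat -> R -> R) (A : nat -> set R) :
  (forall n y, 0 <= f n y) -> (forall n, A n !=set0) ->
  (fun n => ereal_sup [set (f n y)%:E | y in A n]) @ \oo --> 0%E <->
  forall eps : R, 0 < eps -> exists N : nat, forall n y, (N <= n)%N -> A n y ->
    f n y <= eps.
Proof.
move=> f0 A0; set s := fun n => ereal_sup _.
have ub n y : A n y -> ((f n y)%:E <= s n)%E.
  by move=> Ay; apply: ereal_sup_ubound; exists y.
have s0 n : (0%:E <= s n)%E.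
  by have [y Ay] := A0 n; apply: le_trans (ub _ _ Ay); rewrite lee_fin.
split.
- move=> /fine_cvgP[/near_inftyP[N1 H1] /cvgrPdist_le hf] eps eps0.
  have /near_inftyP[N2 H2] := hf _ eps0.
  exists (maxn N1 N2) => n y; rewrite geq_max => /andP[/H1 fin /H2 h] /ub.
  rewrite -(fineK fin) lee_fin => /le_trans; apply.
  by move: h; rewrite sub0r normrN; apply: le_trans; exact: ler_norm.
- move=> h; have le_eps eps : 0 < eps -> exists N : nat, forall n, (N <= n)%N ->
      (s n <= eps%:E)%E.
    move=> /h[N HN]; exists N => n Nn; apply: ge_ereal_sup => _ [y Ay <-].
    by rewrite lee_fin; exact: HN.
  have fin eps n : (s n <= eps%:E)%E -> s n \is a fin_num.
    by move=> se; rewrite ge0_fin_numE// (le_lt_trans se) ?ltry.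
  apply/fine_cvgP; split.
    have [N HN] := le_eps 1 ltr01; apply/near_inftyP.
    by exists N => n /HN; exact: fin.
  apply/cvgrPdist_le => eps eps0; have [N HN] := le_eps _ eps0.
  apply/near_inftyP; exists N => n /HN se.
  rewrite sub0r normrN /= ger0_norm ?fine_ge0//.
  by rewrite -lee_fin fineK//; exact: fin se.
Qed.

Lemma limn_esup_lt (R : realType) (u : nat -> R) (b : \bar R) :
  (limn_esup (fun n => (u n)%:E) < b)%E ->
  exists c : \bar R, (c < b)%E /\ exists N : nat, forall n, (N <= n)%N -> ((u n)%:E <= c)%E.
Proof.
move=> /ereal_inf_lt[_ [V [N _ HN] <-] hb]; exists (ereal_sup ((fun n => (u n)%:E) @` V)).
split => //; exists N => n Nn; apply: ereal_sup_ubound; exists n => //; exact: HN.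
Qed.

Lemma limn_einf_gt0 (R : realType) (u : nat -> R) :
  (0 < limn_einf (fun n => (u n)%:E))%E ->
  exists2 c : R, 0 < c & exists N : nat, forall n, (N <= n)%N -> c <= u n.
Proof.
rewrite /limn_einf oppe_gt0 => /(@limn_esup_lt _ (fun n => - u n)).
move=> [c [c0 [N HN]]]; have := HN N (leqnn N).
case: c c0 HN => [c| |] //; rewrite lte_fin => c0 HN _.
exists (- c); first by rewrite oppr_gt0.
by exists N => n /HN; rewrite lee_fin lerNl.
Qed.

Lemma limn_esup_eq0 (R : realType) (u : nat -> R) :
  limn_esup (fun n => (u n)%:E) = 0%E ->
  forall e : R, 0 < e -> exists N : nat, forall n, (N <= n)%N -> u n <= e.
Proof.
move=> u0 e e0; have [|c [ce [N HN]]] := @limn_esup_lt _ u e%:E.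
  by rewrite u0 lte_fin.
by exists N => n /HN/le_lt_trans/(_ ce); rewrite lte_fin => /ltW.
Qed.

(** For large [x], [l x] is [x * F x], so that [lam * F (lam * x) / F x] is [l (lam * x) / l x]. *)
Lemma slowly_varying_regular_tail (R : realType) (F l : R -> R) :
  (forall x, 0 <= F x <= 1) -> (forall x y, x <= y -> F y <= F x) ->
  slowly_varying l -> (\forall x \near +oo, F x = x^-1 * l x) ->
  regular_tail R F.
Proof.
move=> F01 Fni sv [M0 [_ FM]].
have svE lam e : 0 < lam -> 0 < e -> exists M : R, forall x, M < x ->
    `|1 - l (lam * x) / l x| <= e.
  move=> lam0 e0; have /cvgrPdist_le/(_ _ e0)[M [_ HM]] := sv _ lam0.
  by exists M.
(* Division by zero returns zero, so a zero of [l] far out would put the quotient for [lam = 1] at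
   distance 1 from its limit. *)
have l0 : exists M : R, forall x, M < x -> l x != 0.
  have [M HM] := svE 1 (1 / 2) ltr01 ltac:(lra); exists M => x /HM.
  by apply: contraTneq => ->; rewrite invr0 mulr0 subr0 normr1 -ltNge; lra.
have [M1 HM1] := l0.
(* Positivity holds far out, where [l] does not vanish, and spreads to the left by monotonicity. *)
have Fpos x : 0 < F x.
  pose y := `|x| + `|M0| + `|M1| + 1.
  have xy : x <= y by rewrite /y; have := ler_norm x; have := normr_ge0 M0;
    have := normr_ge0 M1; lra.
  have y0 : 0 < y by rewrite /y; have := normr_ge0 x; have := normr_ge0 M0;
    have := normr_ge0 M1; lra.
  have yM0 : M0 < y by rewrite /y; have := normr_ge0 x; have := ler_norm M0;
    have := normr_ge0 M1; lra.
  have yM1 : M1 < y by rewrite /y; have := normr_ge0 x; have := normr_ge0 M0;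
    have := ler_norm M1; lra.
  apply: lt_le_trans (Fni _ _ xy); rewrite lt_neqAle; have /andP[-> _] := F01 y.
  by rewrite andbT eq_sym (FM _ yM0) mulf_neq0 ?HM1// invr_eq0 gt_eqF.
split => // [x|lam e lam0 e0]; first by have /andP[] := F01 x.
have [M2 HM2] := svE _ _ lam0 e0.
exists (`|M0| + `|M0| / lam + `|M1| + `|M2| + 1) => x hx.
have p0 := normr_ge0 M0; have p1 := normr_ge0 M1; have p2 := normr_ge0 M2.
have pl : 0 <= `|M0| / lam by rewrite divr_ge0// ltW.
have q0 := ler_norm M0; have q1 := ler_norm M1; have q2 := ler_norm M2.
have x0 : 0 < x by lra.
have FxE : F x = x^-1 * l x by apply: FM; lra.
have FlE : F (lam * x) = (lam * x)^-1 * l (lam * x).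
  apply: FM; apply: le_lt_trans q0 _.
  by rewrite mulrC -ltr_pdivrMr//; lra.
have lx0 : l x != 0 by apply: HM1; lra.
have -> : lam * F (lam * x) - F x = (l (lam * x) / l x - 1) * F x.
  by rewrite FlE FxE; field; rewrite lx0 !gt_eqF.
rewrite normrM (gtr0_norm (Fpos x)) ler_pM2r// distrC; apply: HM2; lra.
Qed.

Theorem theorem1 (d : measure_display) (T : measurableType d) (R : realType)
    (P : probability T R) (xi : nat -> T -> R) :
  iid_nonneg P xi ->
  (exists l : R -> R, slowly_varying l /\
     \forall x \near +oo, tailF P xi x = x^-1 * l x) ->
  (* (a) *)
  (forall x : nat -> R, (forall n, 0 < x n) ->
     ((fun n => ereal_sup [set (`| tailFn P xi n y / (n%:R * tailF P xi y) - 1 |)%:E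
                           | y in [set y | x n <= y]]) @ \oo --> 0%E
      <->
      (fun n => x n / (n%:R * Gint P xi (x n))) @ \oo --> +oo)) /\
  (* (b) *)
  (forall x x' a : nat -> R,
     (forall n, 0 < x n) -> (forall n, 0 < x' n) -> (forall n, x n <= x' n) ->
     (0 < limn_einf (fun n => (x n / (n%:R * Gint P xi (x n)))%:E))%E ->
     (limn_esup (fun n => (x' n / (n%:R * Gint P xi (x' n)))%:E) < +oo)%E ->
     (forall n, 0 < a n) ->
     (exists2 alpha : R, 0 < alpha & a @ \oo --> alpha) ->
     (fun n => ereal_sup
        [set (`| tailFn P xi n (n%:R * Gint P xi y + a n * y)
                 / (n%:R * tailF P xi (a n * y)) - 1 |)%:E
        | y in [set y | x n <= y <= x' n]]) @ \oo --> 0%E) /\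
  (* (c) *)
  (forall x : nat -> R, (forall n, 0 < x n) ->
     limn_esup (fun n => (x n / (n%:R * Gint P xi (x n)))%:E) = 0%E ->
     (fun n => tailFn P xi n (x n)) @ \oo --> (1 : R)).
Proof.
move=> iid [l [sv Fl]].
have rF : regular_tail R (tailF P xi).
  apply: slowly_varying_regular_tail sv Fl; first exact: tailF01 iid.
  exact: tailF_ni iid.
have pG := Gint_primitive P xi iid.
have nG0 n y : (0 < n)%N -> 0 < y -> 0 < n%:R * Gint P xi y.
  by move=> n0 y0; rewrite mulr_gt0 ?ltr0n// (prim_gt0 rF pG).
split; [|split].
- move=> x x0.
  rewrite (cvg_sup0P R (fun n y => `|tailFn P xi n y / (n%:R * tailF P xi y) - 1|)
    (fun n => [set y | x n <= y]))//; last by move=> n; exists (x n) => /=.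
  split=> [H|/cvgryPge H].
    apply/cvgryPge => K; pose K' := Num.max 1 K.
    have [|N HN] := ratio_of_large_deviations P xi iid rF x x0 H K'.
      by rewrite lt_max ltr01.
    (* The successor excludes [n = 0], where the quotient is zero by convention. *)
    apply/near_inftyP; exists N.+1 => n Nn.
    rewrite ler_pdivlMr ?nG0 ?(leq_trans _ Nn)//.
    apply: le_trans (HN n (ltnW Nn)); rewrite ler_pM2r ?nG0 ?(leq_trans _ Nn)//.
    by rewrite /K' le_max lexx orbT.
  apply: (large_deviations_of_ratio P xi iid rF x x0) => K K0.
  have /near_inftyP[N HN] := H K; exists N.+1 => n Nn.
  by have := HN n (ltnW Nn); rewrite ler_pdivlMr ?nG0 ?(leq_trans _ Nn).
- move=> x x' a x0 _ xx' /limn_einf_gt0[c c0 [N1 H1]] _ _ [alpha al0 /cvgrPdist_le].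
  move=> /(_ (alpha / 2) ltac:(lra))/near_inftyP[N2 H2].
  apply/(cvg_sup0P R (fun n y => `|tailFn P xi n (n%:R * Gint P xi y + a n * y)
                 / (n%:R * tailF P xi (a n * y)) - 1|)
    (fun n => [set y | x n <= y <= x' n])) => // [n|eps eps0].
    by exists (x n); rewrite /= lexx xx'.
  (* Eventually [a n] is within [alpha / 2] of [alpha], hence in the compact interval from
     [alpha / 2] to [2 * alpha]. *)
  have [||N3 H3] := uniform_large_deviations P xi iid rF c (alpha / 2) (2 * alpha) eps c0
    _ _ eps0; [lra|lra|].
  exists (maxn N1 (maxn N2 N3)).+1 => n y Nn /andP[xy _].
  move: (Nn) => /ltnW; rewrite !geq_max => /and3P[N1n N2n N3n].
  have := H2 n N2n; rewrite ler_norml => /andP[h1 h2].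
  apply: H3 => //; [exact: lt_le_trans (x0 n) xy| |lra|lra].
  (* The lower bound on the ratio at [x n] extends to every [y >= x n] by monotonicity. *)
  apply: (prim_ratio_mono P xi iid rF _ _ _ (x0 n) xy).
  rewrite -mulrA -ler_pdivlMr ?nG0 ?(leq_trans _ Nn)//; exact: H1.
- move=> x x0 /limn_esup_eq0 H.
  have Hx : forall e : R, 0 < e -> exists N : nat, forall n, (N <= n)%N ->
      x n <= e * (n%:R * Gint P xi (x n)).
    move=> e /H[N HN]; exists N.+1 => n Nn.
    by have := HN n (ltnW Nn); rewrite ler_pdivrMr ?nG0 ?(leq_trans _ Nn).
  apply/cvgrPdist_le => e e0; apply/near_inftyP.
  have [N HN] := tail_cvg1_of_ratio P xi iid rF x x0 Hx e e0.
  exists N => n /HN h.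
  have T1 : tailFn P xi n (x n) <= 1.
    by apply: pr_le1; exact: (measurable_tail_event P xi iid).
  by rewrite ger0_norm; lra.
Qed.
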